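(* Let $X$ be a complex Banach space with an unconditional Schauder basis $(e_j)_{j\ge 1}$. Then the monomials $e^{*\alpha}$, $\alpha\in\mathbb N_0^{(\mathbb N)}$, associated with this basis form a Schauder basis of $(\mathcal H(X),\tau_0)$ in every compatible ordering.
   Context: $\mathcal H(X)$ is the space of entire holomorphic functions $X\to\mathbb C$, and $\tau_0$ is the compact-open topology, generated by the seminorms $\|f\|_K=\sup_{x\in K}|f(x)|$, $K\subset X$ compact. A Schauder basis of a locally convex space is understood in the usual sense (unique convergent expansions with continuous coefficient functionals). Let $(e_j^* )$ be the coefficient functionals of $(e_j)$. $\mathbb N_0^{(\mathbb N)}$ is the set of finitely supported multi-indices $\alpha=(\alpha_j)_{j\ge1}$, $\alpha_j\in\mathbb N_0$; $|\alpha|=\sum_j\alpha_j$ (the degree); $\operatorname{len}(\alpha)=\max\operatorname{supp}(\alpha)$, with $\operatorname{len}(0)=0$; and $e^{*\alpha}(x)=\prod_j e_j^*(x)^{\alpha_j}$. Square order: for multi-indices $\alpha,\beta$ of the same degree, $\alpha\prec\beta$ if either (i) $\operatorname{len}(\alpha)<\operatorname{len}(\beta)$, or (ii) $\operatorname{len}(\alpha)=\operatorname{len}(\beta)$ and, for $j=\max\{i:\alpha_i\ne\beta_i\}$, one has $\alpha_j<\beta_j$. An ordering (enumeration as a sequence) of all monomials is called compatible if, for every $n\in\mathbb N_0$, its restriction to the degree-$n$ monomials agrees with the square order. *)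

(* Defs.v *)
From HB Require Import structures.
From mathcomp Require Import all_boot all_order all_algebra.
From mathcomp Require Import finmap.
From mathcomp Require Import complex.
From mathcomp Require Import all_classical all_reals interval_inference convex.
From mathcomp Require Import topology normedtype sequences derive landau.

Set Implicit Arguments.
Unset Strict Implicit.
Unset Printing Implicit Defensive.

Import Order.TTheory GRing.Theory Num.Theory.
Import numFieldTopology.Exports numFieldNormedType.Exports.

Local Open Scope classical_set_scope.
Local Open Scope ring_scope.

Section schauder_basis.
Context {K : numFieldType} {V : tvsType K}.
Implicit Types (e : nat -> V) (a : nat -> K) (x : V).

Definition expansion e a x := series (fun k => a k *: e k) @ \oo --> x.

(* The n-th coefficient functional; the default value 0 is only taken when x
   has no expansion along e. *)
Definition coef e (n : nat) x : K^o :=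
  xget (fun=> 0) [set a | expansion e a x] n.

Definition schauder_basis e :=
  (forall x, exists! a, expansion e a x) /\ (forall n, continuous (coef e n)).

Definition unconditional e :=
  forall x (p : nat -> nat), bijective p ->
    exists y : V, series (fun k => coef e (p k) x *: e (p k)) @ \oo --> y.

Lemma coef_expansion e x : schauder_basis e -> expansion e (coef e ^~ x) x.
Proof.
move=> [ex _]; have [a [ha _]] := ex x.
exact: (@xgetPex _ (fun=> 0) [set a | expansion e a x] (ex_intro _ a ha)).
Qed.

Lemma coef_unique e a x :
  schauder_basis e -> expansion e a x -> coef e ^~ x = a.
Proof.
move=> he ha; have [b [_ ub]] := he.1 x.
by rewrite -(ub _ ha) -(ub _ (coef_expansion he)).
Qed.

Lemma coef_linear e n : schauder_basis e -> linear (coef e n).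
Proof.
move=> he c x y; pose a k := c * coef e k x + coef e k y.
suff /(coef_unique he)/(congr1 (@^~ n)) : expansion e a (c *: x + y) by [].
rewrite /expansion (_ : series _ =
    (fun n => c *: series (fun k => coef e k x *: e k) n +
              series (fun k => coef e k y *: e k) n)); last first.
  apply/funext => m; rewrite /series/= scaler_sumr -big_split/=.
  by apply: eq_bigr => k _; rewrite scalerDl scalerA.
have hx : expansion e (coef e ^~ x) x := coef_expansion he.
have hy : expansion e (coef e ^~ y) y := coef_expansion he.
have hcx : c *: series (fun k => coef e k x *: e k) m @[m --> \oo] --> c *: x.
  exact: cvg_comp (cvg_pair (cvg_cst (c : K^o)) hx) (@scale_continuous _ _ (c : K^o, x)).
exact: cvg_comp (cvg_pair hcx hy) (@add_continuous _ (c *: x, y)).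
Qed.
End schauder_basis.

Section entire.
Context {K : numFieldType} (X : normedModType K).

(* Frechet differentiability over K at every point: for K = R[i] these are the
   entire holomorphic functions X -> C. The development is kept generic in K
   because unification is very slow when K is instantiated by R[i]. *)
Definition entire_fun : {pred X -> K^o} :=
  [pred f | `[< forall x, differentiable f x >]].

Record entire_space := EntireFun {
  entire_val :> X -> K^o ; _ : entire_val \in entire_fun }.

HB.instance Definition _ := [isSub for entire_val].
HB.instance Definition _ := [Choice of entire_space by <:].

Lemma entire_submod : submod_closed entire_fun.
Proof.
split; first by apply/asboolP => x; exact: differentiable_cst.
move=> c f g /asboolP hf /asboolP hg; apply/asboolP => x.
by apply: differentiableD => //; exact: differentiableZ.
Qed.
HB.instance Definition _ := GRing.isSubmodClosed.Build _ _ entire_fun entire_submod.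
HB.instance Definition _ := [SubChoice_isSubLmodule of entire_space by <:].

(* Topology of uniform convergence on compact sets; on continuous functions it
   is the compact-open topology by compact_open_fam_compactP. *)
HB.instance Definition _ := Uniform.copy entire_space
  (initial_topology (entire_val : entire_space -> {family compact, X -> K^o})).

Implicit Types (f g : entire_space).

Lemma entire_continuous f : continuous f.
Proof.
move=> x; have /asboolP df := valP f; exact: differentiable_continuous (df x).
Qed.

(* That is, the topology is generated by the seminorms
   f |-> sup_(y in A) `|f y| for A compact. *)
Lemma nbhs_entireP f (U : set entire_space) :
  nbhs f U <-> exists (A : set X) (r : K), [/\ compact A, 0 < r &
    [set g : entire_space | forall y, A y -> `|f y - g y| < r] `<=` U].
Proof.
split; last first.
  case=> A [r [cA r0 AU]].
  pose E : set (K^o * K^o) := [set z | ball z.1 r z.2].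
  have entE : entourage E by rewrite -entourage_ballE; exists r => //= -[].
  have fE := @fam_nbhs X K^o compact A E (entire_val f) entE cA.
  have ic : continuous (entire_val : entire_space -> {family compact, X -> K^o}).
    exact: initial_continuous.
  refine (@filterS _ (nbhs f) _ _ U _ (ic f _ fE)) => g /= fg; apply: AU => y Ay.
  by have := fg y Ay; rewrite /E /= -ball_normE.
case=> _ [[/= B oB <-] Bf /=] BU.
pose D := [set Ar : set X * K | compact Ar.1 /\ 0 < Ar.2].
pose N (Ar : set X * K) : set (X -> K^o) :=
  [set g | forall y, Ar.1 y -> `|f y - g y| < Ar.2].
pose F := filter_from D N.
have FF : Filter F.
  apply: filter_from_filter.
    by exists (set0, 1); split => //; exact: compact0.
  move=> [A r] [A' r'] [/= cA r0] [/= cA' r'0].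
  have rr' : r >=< r' by exact: real_comparable (gtr0_real r0) (gtr0_real r'0).
  exists (A `|` A', Num.min r r').
    by split => /=; [exact: compactU|rewrite comparable_lt_min// r0].
  move=> g /= fg; split=> y Ay /=.
    by have := fg y (or_introl Ay); rewrite comparable_lt_min// => /andP[].
  by have := fg y (or_intror Ay); rewrite comparable_lt_min// => /andP[].
have Ff : {family compact, F --> (f : X -> K^o)}.
  apply/fam_cvgP => A cA P /uniform_nbhs[E [entE EP]].
  move: entE; rewrite -entourage_ballE => -[r /= r0 rE].
  exists (A, r) => // g /= fg; apply: EP => y Ay; apply: rE => /=.
  by rewrite -ball_normE; exact: fg.
have : nbhs (entire_val f : {family compact, X -> K^o}) B.
  exact: open_nbhs_nbhs.
move=> /Ff[[A r] [/= cA r0] AB]; exists A, r; split => // g fg.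
by apply: BU; exact: AB.
Qed.

Lemma entire_add_continuous :
  continuous (fun z : entire_space * entire_space => z.1 + z.2).
Proof.
move=> [/= f g] U /nbhs_entireP[A [r [cA r0 AU]]].
have r20 : 0 < r / 2 by rewrite divr_gt0.
exists ([set f' : entire_space | forall y, A y -> `|f y - f' y| < r / 2],
        [set g' : entire_space | forall y, A y -> `|g y - g' y| < r / 2]).
  by split; apply/nbhs_entireP; exists A, (r / 2); split.
move=> [f' g'] /= [ff' gg']; apply: AU => y Ay.
rewrite [r]splitr /= opprD addrACA (le_lt_trans (ler_normD _ _))//.
by rewrite ltrD ?ff' ?gg'.
Qed.

Lemma entire_scale_continuous :
  continuous (fun z : K^o * entire_space => z.1 *: z.2).
Proof.
move=> [/= c f] U /nbhs_entireP[A [r [cA r0 AU]]].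
have r20 : 0 < r / 2 by rewrite divr_gt0.
have cf : \forall l \near (c : K^o), A `<=` (fun y => `|(c - l) * f y| < r / 2).
  have /compact_near_coveringP cA' := cA.
  apply: (cA' K^o (nbhs (c : K^o)) (fun l y => `|(c - l) * f y| < r / 2)) => x Ax.
  have : (c - z.2) * f z.1 @[z --> (x, c : K^o)] --> (0 : K^o).
    rewrite -(mul0r (f x)) -(subrr c).
    apply: cvgM; first by apply: cvgB; [exact: cvg_cst|exact: cvg_snd].
    by apply: cvg_comp; [exact: cvg_fst|exact: entire_continuous].
  by move=> /cvgr0Pnorm_lt/(_ _ r20).
pose M := `|c| + 1; have M0 : 0 < M by rewrite ltr_wpDl.
exists ([set l : K^o | `|l| < M /\ A `<=` (fun y => `|(c - l) * f y| < r / 2)],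
        [set g : entire_space | forall y, A y -> `|f y - g y| < r / 2 / M]).
  split; last by apply/nbhs_entireP; exists A, (r / 2 / M); rewrite !divr_gt0//; split.
  apply: filterI => //; near=> l => /=.
  have : `|c - l| < 1 by near: l; apply: cvgr_dist_lt.
  move=> cl; rewrite -(subrK c l) (le_lt_trans (ler_normD _ _))// addrC ltrD2l.
  by rewrite distrC.
move=> [l g] /= [[lM cl] fg]; apply: AU => y Ay /=.
rewrite (_ : _ - _ = (c - l) * f y + l * (f y - g y)); last first.
  by rewrite mulrBl mulrBr addrA subrK.
rewrite [r]splitr (le_lt_trans (ler_normD _ _))// ltr_leD ?cl//.
rewrite normrM (@le_trans _ _ (M * (r / 2 / M)))//.
  by rewrite ler_pM// ltW// fg.
by rewrite mulrC divfK// gt_eqF.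
Unshelve. all: by end_near. Qed.

Local Open Scope convex_scope.

Lemma entire_locally_convex : exists2 B : set_system entire_space,
  (forall b, b \in B -> convex_set b) & basis B.
Proof.
pose b f (A : set X) (r : K) : set entire_space :=
  [set g | exists s : K, [/\ 0 < s, s < r & forall y, A y -> `|f y - g y| <= s]].
exists [set B | exists f A r, compact A /\ B = b f A r].
  move=> _ /[!inE] -[f [A [r [cA ->]]]].
  apply/convex_setW => g h /[!inE] -[s [s0 sr gs]] -[t [t0 tr ht]] l l0 l1.
  rewrite inE; set k := l%:num in l0 l1 *; pose k' := 1 - k.
  have k'0 : 0 < k' by rewrite subr_gt0.
  exists (k * s + k' * t); split.
  - by rewrite addr_gt0// mulr_gt0.
  - rewrite -[ltRHS]mul1r -[X in _ < X * _](subrKC k) [ltRHS]mulrDl.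
    by rewrite ltrD// ltr_pM2l.
  - move=> y Ay; rewrite (_ : _ - _ = k * (f y - g y) + k' * (f y - h y)).
      rewrite (le_trans (ler_normD _ _))// !normrM.
      rewrite (gtr0_norm l0) (gtr0_norm k'0).
      by rewrite lerD// ler_wpM2l ?gs ?ht// ltW.
    rewrite !mulrBr addrACA -mulrDl subrKC mul1r -opprD.
    by [].
split.
  move=> _ [f [A [r [cA ->]]]]; rewrite openE => g [s [s0 sr gs]].
  apply/nbhs_entireP; exists A, ((r - s) / 2); split => //.
    by rewrite divr_gt0// subr_gt0.
  move=> h gh; exists (s + (r - s) / 2); split.
  - by rewrite addr_gt0// divr_gt0// subr_gt0.
  - by rewrite -ltrBrDl ltr_pdivrMr// ltr_pMr ?subr_gt0// ltr1n.
  - move=> y Ay; rewrite -(subrK (g y) (f y)) -addrA (le_trans (ler_normD _ _))//.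
    by rewrite lerD ?gs// ltW// gh.
move=> f U /nbhs_entireP[A [r [cA r0 AU]]].
exists (b f A r).
  split; first by exists f, A, r.
  exists (r / 2); split; first by rewrite divr_gt0.
    by rewrite ltr_pdivrMr// ltr_pMr// ltr1n.
  by move=> y Ay; rewrite subrr normr0 ltW// divr_gt0.
by move=> g [s [s0 sr gs]]; apply: AU => y Ay; exact: le_lt_trans (gs _ Ay) sr.
Qed.

HB.instance Definition _ :=
  PreTopologicalNmodule_isTopologicalNmodule.Build entire_space entire_add_continuous.
HB.instance Definition _ :=
  TopologicalNmodule_isTopologicalLmodule.Build K entire_space entire_scale_continuous.
HB.instance Definition _ :=
  Uniform_isTvs.Build K entire_space entire_locally_convex.

End entire.

Arguments entire_fun {K} X _.

Definition multiindex := {fsfun nat -> nat with 0%N}.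

(* Indices start at 0, so position i here is position i + 1 of a sequence
   indexed from 1; hence the successor in mlen, which makes mlen 0 = 0 and keeps
   the zero multi-index apart from those supported at position 0. *)
Implicit Types al be : multiindex.

Definition mdegree al : nat := (\sum_(i <- finsupp al) al i)%N.

Definition mlen al : nat := (\max_(i <- finsupp al) i.+1)%N.

Definition square_lt al be : Prop :=
  (mlen al < mlen be)%N \/
  mlen al = mlen be /\
  exists2 j : nat, al j <> be j /\ (forall i, al i <> be i -> (i <= j)%N)
                 & (al j < be j)%N.

Definition compatible_ordering (s : nat -> multiindex) : Prop :=
  bijective s /\
  forall m n, mdegree (s m) = mdegree (s n) ->
    (m < n)%N <-> square_lt (s m) (s n).

Section monomial.
Context {K : numFieldType} {X : normedModType K} (e : nat -> X).

Definition monomial_fun al (x : X) : K^o :=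
  \prod_(i <- finsupp al) coef e i x ^+ al i.

Lemma monomial_entire al : schauder_basis e -> monomial_fun al \in entire_fun X.
Proof.
move=> he; apply/asboolP => x.
have dc i : differentiable (coef e i) x.
  pose L := GRing.isLinear.Build _ _ _ _ (coef e i) (coef_linear i he).
  pose f : {linear X -> K^o} := HB.pack (coef e i) L.
  exact: (@linear_differentiable _ _ _ f x (he.2 i)).
rewrite /monomial_fun; elim: (enum_fset (finsupp al)) => [|i s ih].
  by under eq_fun do rewrite big_nil; exact: differentiable_cst.
under eq_fun do rewrite big_cons.
apply: (@differentiableM _ _ (fun y => coef e i y ^+ al i)) => //.
elim: (al i) => [|n ihn]; first exact: differentiable_cst.
under eq_fun do rewrite exprS.
exact: differentiableM.
Qed.

Definition monomial (he : schauder_basis e) al : entire_space X :=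
  EntireFun (monomial_entire al he).

End monomial.

(* Main.v *)
Require Import Defs.
From mathcomp Require Import all_boot all_order all_algebra complex finmap.
From mathcomp Require Import all_classical all_reals topology normedtype sequences derive.
From mathcomp Require Import ring zify.

Set Implicit Arguments.
Unset Strict Implicit.
Unset Printing Implicit Defensive.

Import Order.TTheory GRing.Theory Num.Theory.
Import numFieldTopology.Exports numFieldNormedType.Exports.
Local Open Scope ring_scope.
Local Open Scope classical_set_scope.

(** Split an entire function [f] into homogeneous Taylor parts, f = sum_d P_d.
    On the span of e_0, ..., e_(m-1) each P_d is a polynomial in the
    coordinates, and the monomial coefficients of [f] are averages of [f] over
    a torus in such a span. The point is convergence: already on l_2 the
    monomial series of a 2-homogeneous polynomial need not converge absolutely,
    so the order of summation matters.

    Within one degree the square order is the colexicographic order of the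
    exponents. An initial segment { be <= al } splits according to the exponent
    of the last variable: either be_m < al_m, or be_m = al_m and the remaining
    exponents form an initial segment in fewer variables. The terms of a
    polynomial p whose last exponent is k are an average of p over rotations of
    that variable, hence bounded by the supremum of |p| on the polydisc. By
    induction, the partial sum over an initial segment ending at al is bounded
    by |al| + 1 times that supremum ([colex_partial_sum_le]); the bound depends
    on the degree, but not on the number of variables. For a fixed x this is
    applied to p(t) = P_d(t.x), where t.x = sum_i t_i x_i e_i. The Cauchy
    estimate on the circle of radius 4 gives |P_d| a factor 4^-d, which absorbs
    d + 1. Hence, in any compatible ordering, the partial sums are controlled
    by the values of [f] at the points t.x with |t_i| <= 4, and the differences
    P_d(t.x) - P_d(t.y), y a section of x, control the convergence
    ([monomial_expansion_uniform]).

    Unconditionality enters through these multipliers: for x in a compact set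
    and |t_i| <= 4 the series t.x converge uniformly, so [f] is bounded on all
    these points and f(t.x) is the uniform limit of its values on the sections
    ([multiplier_cvg_uniform], [multiplier_bounded]).
    Uniqueness of the expansion and continuity of its coefficients hold because
    a coefficient is bounded by the supremum of |f| on a compact polydisc
    ([coefficient_dist], [coefficient_sub]).

    The complex analysis uses no integrals. Circle integrals are replaced by
    averages over 2^L-th roots of unity. The bisection proof of Goursat's lemma
    works verbatim for trapezoidal sums ([discrete_goursat]), because these are
    exact on affine functions and cancel on common edges. It yields a Cauchy
    formula in the limit ([cauchy_formula]), and from that an explicit error
    bound for interpolation at roots of unity ([interpolation_error]).
    Applied to one coordinate after another, interpolation approximates [f] by
    polynomials, uniformly on polydiscs ([polynomial_approximation]). Averages of
    polynomials are eventually exact, so identities between limits of averages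
    need to be checked on polynomials only ([homogeneous_part_expansion]).

    All of this works over an algebraically closed normed field that is
    archimedean and has compact balls; the complex numbers enter at the very
    end. *)

(** * The scalar field *)

Definition archimedean_field (K : numFieldType) := forall x : K, exists n, `|x| < n%:R.

Definition compact_balls (K : numFieldType) :=
  forall r : K, compact [set z : K^o | `|z| <= r].

(** The order of a [numFieldType] is partial, hence the realness assumptions. *)
Lemma ler_eps (K : numFieldType) (x y : K) : x \is Num.real -> y \is Num.real ->
  (forall eps, 0 < eps -> x <= y + eps) -> x <= y.
Proof.
move=> xr yr h; rewrite real_leNgt//; apply/negP => yx.
have e0 : 0 < (x - y) / 2 by rewrite divr_gt0// subr_gt0.
have := h _ e0; rewrite -lerBlDl real_leNgt ?realB//; last by rewrite gtr0_real.
by rewrite ltr_pdivrMr// ltr_pMr ?subr_gt0// ltr1n.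
Qed.

Lemma closed_norm_ball (K : numFieldType) (V : normedModType K) (r : K) :
  closed [set z : V | `|z| <= r].
Proof.
move=> z clz; have [|rr] := boolP (0 <= r); last first.
  have [y [/= yr _]] := clz setT filterT.
  by rewrite (le_trans _ yr) in rr.
move=> r0 /=; apply: ler_eps; rewrite ?normr_real ?ger0_real// => eps e0.
have [y [/= yr zy]] := clz _ (nbhsx_ballx z eps e0).
rewrite -(subrK y z) (le_trans (ler_normD _ _))// addrC lerD// ltW//.
by rewrite -ball_normE in zy.
Qed.

Lemma expr2_unbounded (K : numFieldType) : archimedean_field K ->
  forall x : K, exists n, `|x| < 2 ^+ n.
Proof.
move=> archK x; have [n xn] := archK x; exists n; apply: lt_trans xn _.
by rewrite -natrX ltr_nat ltn_expl.
Qed.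

Lemma half_pow_small (K : numFieldType) : archimedean_field K ->
  forall C eps : K, 0 < eps -> exists n, forall m, (n <= m)%N -> `|C| / 2 ^+ m < eps.
Proof.
move=> archK C eps e0; have [n Cn] := expr2_unbounded archK (C / eps).
exists n => m nm; rewrite ltr_pdivrMr ?exprn_gt0// mulrC -ltr_pdivrMr//.
move: Cn; rewrite normrM normfV (gtr0_norm e0) => /lt_le_trans; apply.
by rewrite ler_eXn2l// ltr1n.
Qed.

Lemma complex_archimedean (R : realType) : archimedean_field R[i].
Proof.
move=> x; exists (Num.truncn (complex.Re `|x|)).+1.
rewrite -[X in _ < X%:R]/(_ : nat) -(rmorph_nat (real_complex R)).
have -> : `|x| = (complex.Re `|x|)%:C%C by rewrite normc_def.
by rewrite ltcR truncnS_gt.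
Qed.

Lemma complex_ball_compact (R : realType) : compact_balls R[i].
Proof.
move=> r; have [|rn0] := boolP (0 <= r); last first.
  rewrite (_ : [set _ | _] = set0) ?eqEsubset; first exact: compact0.
  by split=> // z /= zr; rewrite (le_trans _ zr) in rn0.
rewrite lecE /= => /andP[/eqP im_r re_r].
have -> : r = (complex.Re r)%:C%C by case: r im_r re_r => a b /= ->.
move: {r im_r re_r} (complex.Re r) => r.
pose F (p : R * R) : R[i]^o := (p.1 +i* p.2)%C.
have cF : continuous F.
  move=> [a b]; apply/cvgrPdist_lt => eps.
  rewrite ltcE /= => /andP[/eqP im_e re_e].
  have e20 : 0 < complex.Re eps / 2 by rewrite divr_gt0.
  near=> p.
  have -> : eps = (complex.Re eps)%:C%C by case: (eps) im_e => ? ? /= ->.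
  rewrite (_ : F (a, b) - F p = (a - p.1)%:C%C + 'i%C * (b - p.2)%:C%C); last first.
    by rewrite /F/=; simpc.
  rewrite (le_lt_trans (ler_normD _ _))// normrM !normc_def /= !(expr0n, addr0, add0r, expr1n) /=.
  rewrite sqrtr1 -rmorphM /= mul1r -rmorphD ltcR !sqrtr_sqr [ltRHS]splitr.
  rewrite ltrD//; near: p.
    by apply: (@cvgr_dist_lt _ _ _ _ _ (@fst R R) a) => //; exact: cvg_fst.
  by apply: (@cvgr_dist_lt _ _ _ _ _ (@snd R R) b) => //; exact: cvg_snd.
apply: (@subclosed_compact _ _ (F @` (`[-r, r] `*` `[-r, r]))).
- exact: closed_norm_ball.
- apply: continuous_compact; first exact: continuous_subspaceT.
  by apply: compact_setX; exact: segment_compact.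
- move=> z /= zr; exists (complex.Re z, complex.Im z); last by case: z zr.
  move: zr; rewrite normc_def lecR => zr; rewrite /= !in_itv/= -!ler_norml -!sqrtr_sqr.
  by split; rewrite (le_trans _ zr)// ler_wsqrtr// (lerDl, lerDr) sqr_ge0.
Unshelve. all: by end_near. Qed.

(** * Dyadic roots of unity and their averages *)

Section roots_of_unity.
Context {K : numClosedFieldType}.

(** The square root in the closed right half-plane. Taking it repeatedly halves
    the argument, so that the chosen roots of unity tend to 1. *)
Definition right_sqrt (z : K) : K :=
  if 0 <= 'Re (sqrtC z) then sqrtC z else - sqrtC z.

(** [omega n] is a primitive root of unity of order 2^n and the square of
    [omega n.+1], so the grids of its powers refine each other. *)
Fixpoint omega (n : nat) : K :=
  match n with 0%N => 1 | n'.+1 => if n' is 0%N then -1 else right_sqrt (omega n') end.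

Lemma right_sqrtK z : right_sqrt z ^+ 2 = z.
Proof. by rewrite /right_sqrt; case: ifP => _; rewrite ?sqrrN sqrtCK. Qed.

Lemma Re_right_sqrt z : 0 <= 'Re (right_sqrt z).
Proof.
rewrite /right_sqrt; case: ifPn => // h.
rewrite raddfN oppr_ge0; have := Creal_Re (sqrtC z); rewrite realE.
by rewrite (negPf h).
Qed.

Lemma omegaS n : omega n.+1 ^+ 2 = omega n.
Proof. by case: n => [|n]; [rewrite /= sqrrN expr1n | exact: right_sqrtK]. Qed.

Lemma norm_omega n : `|omega n| = 1.
Proof.
elim: n => [|n ih]; first exact: normr1.
by apply/eqP; rewrite -(@pexpr_eq1 _ _ 2)// -normrX omegaS ih.
Qed.

Lemma Re_omega n : (1 < n)%N -> 0 <= 'Re (omega n).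
Proof. by case: n => [|[|n]]// _; exact: Re_right_sqrt. Qed.

Lemma omega_pow n k : omega (n + k) ^+ (2 ^ k) = omega n.
Proof.
elim: k n => [|k ih] n; first by rewrite addn0 expr1.
by rewrite addnS expnS exprM omegaS ih.
Qed.

Lemma omega_prim n : (2 ^ n).-primitive_root (omega n).
Proof.
have o1 : omega n ^+ (2 ^ n) = 1 by have := omega_pow 0 n; rewrite add0n.
have := prim_order_exists (expn_gt0 2 n) o1 => -[d hd dn].
have /(dvdn_pfactor d n (isT : prime 2))[k kn dk] := dn.
suff -> : (2 ^ n)%N = d by [].
rewrite dk; congr (2 ^ _)%N; apply/eqP; rewrite eqn_leq kn andbT leqNgt; apply/negP => kn'.
have := prim_expr_order hd; rewrite dk => e1.
case: n kn' dn kn hd {o1} e1 => // n kn' _ _ _ e1.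
have : omega n.+1 ^+ (2 ^ n) = 1.
  have -> : (2 ^ n = 2 ^ k * 2 ^ (n - k))%N by rewrite -expnD subnKC.
  by rewrite exprM e1 expr1n.
rewrite -add1n omega_pow /= => /eqP; rewrite -subr_eq0 -opprD oppr_eq0.
by rewrite -[1 + 1]/(2%:R) pnatr_eq0.
Qed.

Lemma omega_order n : omega n ^+ (2 ^ n) = 1.
Proof. exact: prim_expr_order (omega_prim n). Qed.

Lemma omega_neq0 n : omega n != 0.
Proof. by rewrite -normr_gt0 norm_omega. Qed.

(** 2^n |omega n - 1| is the perimeter of the regular 2^n-gon inscribed in the
    unit circle; it increases with n. *)
Lemma norm_omega_sub_ge n : (0 < n)%N -> 4 <= 2 ^+ n * `|omega n - 1|.
Proof.
elim: n => // -[_ _|n ih _].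
  by rewrite /= -opprD normrN (_ : 1 + 1 = 2%:R)// normr_nat expr1 -natrM.
apply: le_trans (ih isT) _.
rewrite [2 ^+ n.+2]exprSr -mulrA ler_wpM2l ?exprn_ge0// -omegaS.
rewrite subr_sqr_1 normrM mulrC ler_wpM2r//.
by rewrite (le_trans (ler_normD _ _))// norm_omega normr1.
Qed.

(** The dual fact: the perimeter of the circumscribed 2^n-gon, which is
    2^(n+1) |omega n - 1| / |omega n + 1|, decreases with n. With c the real part
    of omega (n+1), this comes down to c <= 1. *)
Lemma norm_omega_sub_half n : (1 < n)%N ->
  2 ^+ n * `|omega n - 1| <= 4 * `|omega n + 1|.
Proof.
elim: n => // -[_//|[_ _|n ih _]].
  set w := omega 2; have w2 : w ^+ 2 = -1 by exact: omegaS.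
  rewrite (_ : w - 1 = w * (w + 1)); last by rewrite mulrDr mulr1 -expr2 w2 addrC.
  by rewrite normrM norm_omega mul1r -natrX.
have {}ih := ih isT.
set w := omega n.+3 in ih *; have w2 : w ^+ 2 = omega n.+2 by exact: omegaS.
have nw : `|w| = 1 by exact: norm_omega.
have Rw : 0 <= 'Re w by exact: Re_omega.
have Rw1 : 'Re w <= 1 by rewrite -nw (leif_Re_Creal w).
have E : w * w^* = 1 by rewrite -normCK nw expr1n.
have E2 : w + w^* = 2 * 'Re w by rewrite ReE [RHS]mulrC divfK ?pnatr_eq0.
have h1 : `|omega n.+2 + 1| = 2 * 'Re w.
  rewrite (_ : _ + 1 = w * (w + w^*)); last by rewrite mulrDr E -expr2 w2.
  by rewrite normrM nw mul1r E2 ger0_norm ?mulr_ge0.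
have h2 : `|w + 1| ^+ 2 = 2 + 2 * 'Re w.
  rewrite normCK rmorphD rmorph1 -E2.
  rewrite (_ : _ * _ = w * w^* + 1 + (w + w^*)); last by ring.
  by rewrite E.
have w1 : 0 < `|w + 1|.
  rewrite normr_gt0; apply/eqP => w10; move: h2; rewrite w10 normr0 expr0n /= => /esym/eqP.
  by apply/negP; rewrite gt_eqF// ltr_wpDr// mulr_ge0.
rewrite -(ler_pM2r w1) -[leRHS]mulrA -expr2 h2 -mulrA -normrM -subr_sqr_1 w2.
rewrite exprS -mulrA (le_trans (ler_wpM2l _ ih))// h1.
rewrite -subr_ge0 (_ : _ - _ = 8 * (1 - 'Re w)); last by ring.
by rewrite mulr_ge0// subr_ge0.
Qed.

Lemma norm_omega_sub_le n : `|omega n - 1| <= 8 / 2 ^+ n.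
Proof.
rewrite ler_pdivlMr ?exprn_gt0// mulrC.
have w2 m : `|omega m + 1| <= 2 :> K.
  by rewrite (le_trans (ler_normD _ _))// norm_omega normr1.
case: n => [|[|n]]; first by rewrite subrr normr0 mulr0.
  by rewrite /= -opprD normrN (_ : 1 + 1 = 2%:R)// normr_nat expr1 -natrM ler_nat.
rewrite (le_trans (norm_omega_sub_half _))// (le_trans (ler_wpM2l _ (w2 _)))//.
by rewrite -natrM.
Qed.

(** The circle integral of [g], discretized at the 2^n-th roots of unity. *)
Definition avg (n : nat) (g : K -> K) : K :=
  (2 ^+ n)^-1 * \sum_(j < 2 ^ n) g (omega n ^+ j).

Lemma avgZ n c f : avg n (fun u => c * f u) = c * avg n f.
Proof. by rewrite /avg -mulr_sumr mulrCA. Qed.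

Lemma avgB n f g : avg n (fun u => f u - g u) = avg n f - avg n g.
Proof. by rewrite /avg sumrB mulrBr. Qed.

Lemma avg_sum n (I : Type) (r : seq I) (P : pred I) (F : I -> K -> K) :
  avg n (fun u => \sum_(i <- r | P i) F i u) = \sum_(i <- r | P i) avg n (F i).
Proof.
by rewrite /avg exchange_big/= mulr_sumr.
Qed.

Lemma eq_avg n f g : (forall u, `|u| = 1 -> f u = g u) -> avg n f = avg n g.
Proof.
by move=> fg; congr (_ * _); apply: eq_bigr => j _; rewrite fg// normrX norm_omega expr1n.
Qed.

Lemma norm_avg_le n f M : (forall u, `|u| = 1 -> `|f u| <= M) -> `|avg n f| <= M.
Proof.
move=> fM; rewrite /avg normrM normfV.
rewrite (ger0_norm (exprn_ge0 _ _))// mulrC ler_pdivrMr ?exprn_gt0//.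
rewrite (le_trans (ler_norm_sum _ _ _))// (@le_trans _ _ (\sum_(j < 2 ^ n) M))//.
  by apply: ler_sum => j _; rewrite fM// normrX norm_omega expr1n.
by rewrite sumr_const card_ord -natrX mulr_natr.
Qed.

(** Orthogonality of characters. For k and l below 2^n the average is exact. *)
Lemma avg_mono n k l :
  avg n (fun u => u ^+ k / u ^+ l) = (k == l %[mod 2 ^ n])%:R.
Proof.
rewrite /avg; set w := omega n; have w0 : w != 0 := omega_neq0 n.
have E j : (w ^+ j) ^+ k / (w ^+ j) ^+ l = (w ^+ k / w ^+ l) ^+ j.
  by rewrite expr_div_n -!exprM mulnC [(j * l)%N]mulnC.
under eq_bigr do rewrite E.
have N0 : 2 ^+ n != 0 :> K by rewrite expf_neq0// pnatr_eq0.
rewrite -(eq_prim_root_expr (omega_prim n)) -/w; case: eqP => [->|kl].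
  rewrite divff ?expf_neq0//; under eq_bigr do rewrite expr1n.
  by rewrite sumr_const card_ord natrX mulVf.
set x := w ^+ k / w ^+ l.
have x1 : x - 1 != 0.
  apply/eqP => /eqP; rewrite subr_eq0 => /eqP xE; apply: kl.
  by rewrite -[w ^+ l]mul1r -xE divfK ?expf_neq0.
have : (x - 1) * \sum_(j < 2 ^ n) x ^+ j = 0.
  rewrite -subrX1 /x expr_div_n -!exprM ![(_ * 2 ^ n)%N]mulnC !exprM.
  by rewrite !omega_order !expr1n divr1 subrr.
by move=> /eqP; rewrite mulf_eq0 (negPf x1)/= => /eqP ->; rewrite mulr0.
Qed.

End roots_of_unity.

Arguments omega : simpl never.

(** * A discrete Goursat lemma *)

Section discrete_goursat.
Context {K : numFieldType}.

Definition complex_differentiable_at (h : K -> K) (c : K) := exists l : K,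
  forall eps, 0 < eps -> exists2 d, 0 < d &
    forall z, `|z - c| < d -> `|h z - h c - l * (z - c)| <= eps * `|z - c|.

(** Twice the trapezoidal rule for the integral of [h] over the segment [a, b].
    It is antisymmetric in [a] and [b], which makes common edges of neighbouring
    cells cancel. *)
Definition trapezoid (h : K -> K) (a b : K) := (h a + h b) * (b - a).

(** The trapezoidal sum around the grid cell with lower left corner (i, j). *)
Definition cell (h : K -> K) (p : nat -> nat -> K) i j :=
  trapezoid h (p i j) (p i.+1 j) + trapezoid h (p i.+1 j) (p i.+1 j.+1)
  - trapezoid h (p i j.+1) (p i.+1 j.+1) - trapezoid h (p i j) (p i j.+1).

(** Edges inside the box cancel in pairs, leaving its boundary. *)
Lemma cell_stokes h p i j m m' :
  \sum_(a < m) \sum_(b < m') cell h p (i + a) (j + b) =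
  \sum_(a < m) (trapezoid h (p (i + a) j) (p (i + a).+1 j)
              - trapezoid h (p (i + a) (j + m')) (p (i + a).+1 (j + m')))
  + \sum_(b < m') (trapezoid h (p (i + m) (j + b)) (p (i + m) (j + b).+1)
              - trapezoid h (p i (j + b)) (p i (j + b).+1)).
Proof.
pose H i j := trapezoid h (p i j) (p i.+1 j).
pose V i j := trapezoid h (p i j) (p i j.+1).
transitivity (\sum_(a < m) \sum_(b < m') (H (i + a) (j + b) - H (i + a) (j + b).+1)
   + \sum_(a < m) \sum_(b < m') (V (i + a).+1 (j + b) - V (i + a) (j + b))).
  rewrite -big_split; apply: eq_bigr => a _; rewrite -big_split; apply: eq_bigr => b _.
  by rewrite /cell -/(H _ _) -/(V _ _) -/(H _ _) -/(V _ _) /=; ring.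
congr (_ + _).
  apply: eq_bigr => a _.
  rewrite -(big_mkord xpredT (fun b => H (i + a)%N (j + b)%N - H (i + a)%N (j + b).+1)).
  rewrite -[LHS]opprK -sumrN; under eq_bigr do rewrite opprB -addnS.
  by rewrite (telescope_sumr (fun b => H (i + a)%N (j + b)%N))// addn0 opprB.
rewrite exchange_big; apply: eq_bigr => b _.
rewrite -(big_mkord xpredT (fun a => V (i + a).+1 (j + b)%N - V (i + a)%N (j + b)%N)).
under eq_bigr do rewrite -addnS.
by rewrite (telescope_sumr (fun a => V (i + a)%N (j + b)%N))// addn0.
Qed.

(** Trapezoidal sums integrate affine functions exactly, and these have a
    primitive. *)
Lemma cell_affine h p i j (u v : K) :
  cell (fun z => h z - (u + v * z)) p i j = cell h p i j.
Proof. by rewrite /cell /trapezoid; ring. Qed.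

Context (archK : archimedean_field K) (ballK : compact_balls K).
Context (h : K -> K) (p : nat -> nat -> nat -> K) (C B : K).
Context (p_refine : forall L i j, p L.+1 (2 * i) (2 * j) = p L i j)
  (p_h : forall L i j, (i < 2 ^ L)%N -> `|p L i.+1 j - p L i j| <= C / 2 ^+ L)
  (p_v : forall L i j, (i <= 2 ^ L)%N -> `|p L i j.+1 - p L i j| <= C / 2 ^+ L)
  (p_B : forall L i j, (i <= 2 ^ L)%N -> `|p L i j| <= B)
  (h_diff : forall c : K,
    (forall eps, 0 < eps -> exists L i j, (i <= 2 ^ L)%N /\ `|c - p L i j| < eps) ->
    complex_differentiable_at h c).

Let S l i j n := \sum_(a < 2 ^ n) \sum_(b < 2 ^ n)
  cell h (p (l + n)) (2 ^ n * i + a) (2 ^ n * j + b).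

Let sum_split n (F : nat -> K) i :
  \sum_(a < 2 ^ n.+1) F (2 ^ n.+1 * i + a)%N =
  \sum_(a < 2 ^ n) F (2 ^ n * (2 * i) + a)%N + \sum_(a < 2 ^ n) F (2 ^ n * (2 * i + 1) + a)%N.
Proof.
rewrite -!(big_mkord xpredT (fun a => F (_ + a)%N)).
rewrite (big_cat_nat (n := (2 ^ n)%N)) ?leq_exp2l//=; congr (_ + _).
  by apply: eq_bigr => a _; congr F; rewrite expnS; lia.
rewrite -{1}[(2 ^ n)%N]add0n big_addn (_ : 2 ^ n.+1 - 2 ^ n = 2 ^ n)%N; last by rewrite expnS; lia.
by apply: eq_bigr => a _; congr F; rewrite expnS; lia.
Qed.

Let S_split l i j n : S l i j n.+1 =
  S l.+1 (2 * i) (2 * j) n + S l.+1 (2 * i) (2 * j + 1) n +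
  (S l.+1 (2 * i + 1) (2 * j) n + S l.+1 (2 * i + 1) (2 * j + 1) n).
Proof.
rewrite /S addnS addSn (sum_split n (fun a => \sum_(b < 2 ^ n.+1) cell h (p (l + n).+1) a (2 ^ n.+1 * j + b))).
by congr (_ + _); rewrite -big_split; apply: eq_bigr => a _; rewrite !(sum_split n (cell h _ _)).
Qed.

Let p_refine_pow L n i j : p (L + n) (2 ^ n * i) (2 ^ n * j) = p L i j.
Proof.
elim: n => [|n ih]; first by rewrite addn0 !mul1n.
by rewrite addnS expnS -!mulnA p_refine.
Qed.

Let p_near l n i j a b : (i < 2 ^ l)%N -> (a <= 2 ^ n)%N -> (b <= 2 ^ n)%N ->
  `|p (l + n) (2 ^ n * i + a) (2 ^ n * j + b) - p l i j| <= 2 * C / 2 ^+ l.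
Proof.
move=> il an bn; rewrite -(p_refine_pow l n).
have C0 : 0 <= C.
  by have := le_trans (normr_ge0 _) (@p_v 0 0 0 isT); rewrite expr0 divr1.
have ai k : (k <= 2 ^ n)%N -> (2 ^ n * i + k <= 2 ^ (l + n))%N.
  move=> kn; rewrite addnC expnD; have : (i.+1 * 2 ^ n <= 2 ^ l * 2 ^ n)%N by rewrite leq_mul2r il orbT.
  by lia.
have h1 k : (k <= 2 ^ n)%N ->
    `|p (l + n) (2 ^ n * i + k) (2 ^ n * j) - p (l + n) (2 ^ n * i) (2 ^ n * j)|
      <= k%:R * (C / 2 ^+ (l + n)).
  elim: k => [|k ih] kn; first by rewrite addn0 subrr normr0 mul0r.
  rewrite (le_trans (ler_distD (p (l + n) (2 ^ n * i + k) (2 ^ n * j)) _ _))//.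
  rewrite -natr1 mulrDl mul1r [leRHS]addrC; apply: lerD; last exact: ih (ltnW kn).
  by rewrite addnS; apply: p_h; rewrite -addnS ai.
have h2 k :
    `|p (l + n) (2 ^ n * i + a) (2 ^ n * j + k) - p (l + n) (2 ^ n * i + a) (2 ^ n * j)|
      <= k%:R * (C / 2 ^+ (l + n)).
  elim: k => [|k ih]; first by rewrite addn0 subrr normr0 mul0r.
  rewrite (le_trans (ler_distD (p (l + n) (2 ^ n * i + a) (2 ^ n * j + k)) _ _))//.
  rewrite -natr1 mulrDl mul1r [leRHS]addrC; apply: lerD; last exact: ih.
  by rewrite addnS; apply: p_v; rewrite ai.
rewrite (le_trans (ler_distD (p (l + n) (2 ^ n * i + a) (2 ^ n * j)) _ _))//.
rewrite (le_trans (lerD (h2 b) (h1 a an)))//.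
have D0 : 0 <= C / 2 ^+ (l + n) by rewrite divr_ge0// exprn_ge0.
have -> : 2 * C / 2 ^+ l = (2 ^ n)%:R * (C / 2 ^+ (l + n)) + (2 ^ n)%:R * (C / 2 ^+ (l + n)).
  rewrite natrX exprD invfM; field.
  by rewrite !expf_neq0 ?pnatr_eq0.
by rewrite lerD// ler_wpM2r// ler_nat.
Qed.

(** Goursat's bisection argument. A dyadic box whose refined boundary sums exceed
    eta / 4^l infinitely often has a quarter with the same defect at level l + 1.
    The nested boxes shrink to a point c, where [h] is affine up to an error that
    is small relative to the distance to c; boundary length and this error both
    scale like 2^-l, so the defect is impossible for large l. *)
Lemma discrete_goursat (eta : K) : 0 < eta ->
  exists N, forall L, (N <= L)%N ->
    `|\sum_(a < 2 ^ L) \sum_(b < 2 ^ L) cell h (p L) a b| <= eta.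
Proof.
move=> eta0; apply: contrapT => bad0.
pose bad l (ij : nat * nat) := (ij.1 < 2 ^ l)%N /\ forall N, exists2 n, (N <= n)%N &
  ~ (`|S l ij.1 ij.2 n| <= eta / 4 ^+ l).
have C0 : 0 <= C.
  by have := le_trans (normr_ge0 _) (@p_v 0 0 0 isT); rewrite expr0 divr1.
have step l ij : bad l ij -> exists ij', bad l.+1 ij' /\
    exists a b, [/\ (a < 2)%N, (b < 2)%N & ij' = (2 * ij.1 + a, 2 * ij.2 + b)%N].
  case: ij => i j [/= il badij]; apply: contrapT => nobad.
  have good a b : (a < 2)%N -> (b < 2)%N -> exists N, forall n, (N <= n)%N ->
      `|S l.+1 (2 * i + a) (2 * j + b) n| <= eta / 4 ^+ l.+1.
    move=> a2 b2; apply: contrapT => ng; apply: nobad.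
    exists (2 * i + a, 2 * j + b)%N; split; last by exists a, b.
    split=> /=; first by rewrite expnS; lia.
    move=> N; apply: contrapT => ng'; apply: ng; exists N => n Nn.
    by apply: contrapT => ?; apply: ng'; exists n.
  have [N00 h00] := good 0 0 isT isT. have [N01 h01] := good 0 1 isT isT.
  have [N10 h10] := good 1 0 isT isT. have [N11 h11] := good 1 1 isT isT.
  have [[//|n] Nn] := badij (N00 + N01 + N10 + N11).+1.
  apply; rewrite S_split.
  have -> : eta / 4 ^+ l = eta / 4 ^+ l.+1 + eta / 4 ^+ l.+1 + (eta / 4 ^+ l.+1 + eta / 4 ^+ l.+1).
    by rewrite exprS invfM; field; rewrite expf_neq0 ?pnatr_eq0.
  move: (h00 n) (h01 n) (h10 n) (h11 n); rewrite !addn0 => k00 k01 k10 k11.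
  by rewrite (le_trans (ler_normD _ _))// lerD// (le_trans (ler_normD _ _))// lerD//;
    (apply: k00 || apply: k01 || apply: k10 || apply: k11); lia.
have bad00 : bad 0 (0, 0)%N.
  split=> //= N; apply: contrapT => ng; apply: bad0; exists N => L NL.
  apply: contrapT => ng'; apply: ng; exists L => //; rewrite expr0 divr1 /S add0n muln0.
  exact: ng'.
have /choice[g gP] : forall x : nat * (nat * nat), exists ij', bad x.1 x.2 -> bad x.1.+1 ij' /\
    exists a b, [/\ (a < 2)%N, (b < 2)%N & ij' = (2 * x.2.1 + a, 2 * x.2.2 + b)%N].
  move=> [l ij]; have [bl|nb] := pselect (bad l ij); last by exists (0, 0)%N.
  by have [ij' ?] := step l ij bl; exists ij'.
pose q := fix q l := if l is l'.+1 then g (l', q l') else (0, 0)%N.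
have badq l : bad l (q l) by elim: l => // l ih; exact: (gP (l, q l) ih).1.
have qS l : exists a b, [/\ (a < 2)%N, (b < 2)%N & q l.+1 = (2 * (q l).1 + a, 2 * (q l).2 + b)%N].
  exact: (gP (l, q l) (badq l)).2.
have qD l n : exists a b, [/\ (a < 2 ^ n)%N, (b < 2 ^ n)%N &
    q (l + n)%N = (2 ^ n * (q l).1 + a, 2 ^ n * (q l).2 + b)%N].
  elim: n => [|n [a [b [an bn qE]]]].
    by exists 0%N, 0%N; rewrite addn0 !mul1n !addn0; case: (q l).
  have [a' [b' [a'2 b'2 qE']]] := qS (l + n)%N.
  exists (2 * a + a')%N, (2 * b + b')%N; rewrite addnS qE' qE /= expnS; split; [lia|lia|].
  by congr (_, _); lia.
pose c_ l := p l (q l).1 (q l).2.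
have c_near l n : `|c_ (l + n)%N - c_ l| <= 2 * C / 2 ^+ l.
  have [a [b [an bn qE]]] := qD l n; rewrite /c_ qE /=.
  by apply: p_near; rewrite ?(ltnW an) ?(ltnW bn)//; exact: (badq l).1.
(* The corners of the nested boxes accumulate at c, and boxes shrink. *)
have [c [_ clc]] : [set z : K^o | `|z| <= B] `&` cluster (c_ @ \oo) !=set0.
  by apply: ballK; exists 0%N => // l _ /=; apply: p_B; exact: ltnW (badq l).1.
have c_approx l eps : 0 < eps -> exists n, `|c - c_ (l + n)%N| < eps.
  move=> e0; have [|_ [[m /= lm <-]]] := clc [set z | exists2 m, (l <= m)%N & c_ m = z]
      _ _ (nbhsx_ballx c eps e0); first by exists l => // m lm; exists m.
  by rewrite -ball_normE /= => cm; exists (m - l)%N; rewrite subnKC.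
have c_dist l : `|c - c_ l| <= 2 * C / 2 ^+ l.
  apply: ler_eps; rewrite ?normr_real ?ger0_real ?divr_ge0 ?mulr_ge0 ?exprn_ge0// => eps e0.
  have [n cn] := c_approx l eps e0.
  by rewrite (le_trans (ler_distD (c_ (l + n)%N) _ _))// addrC lerD// ltW.
have [|der Pder] := h_diff (c := c).
  move=> eps e0; have [n cn] := c_approx 0%N eps e0.
  by exists n, (q n).1, (q n).2; rewrite (ltnW (badq n).1).
(* A box at level l has boundary length of order C / 2^l and diameter of order
   C / 2^l, with total constant 32; the 1 keeps the denominator positive. *)
pose eps := eta / (32 * (C ^+ 2 + 1)).
have e0 : 0 < eps by rewrite divr_gt0// mulr_gt0// ltr_wpDl// exprn_ge0.
have [d d0 hd] := Pder eps e0.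
have [l hl] := half_pow_small archK (4 * C) d0.
have {hl} ld : 4 * C / 2 ^+ l < d.
  by have := hl l (leqnn l); rewrite ger0_norm ?mulr_ge0.
have [il /(_ 0%N)[n _]] := badq l; apply.
pose D := 4 * C / 2 ^+ l.
pose u := h c - der * c.
pose h' z := h z - (u + der * z).
have h'_le a b : (a <= 2 ^ n)%N -> (b <= 2 ^ n)%N ->
    `|h' (p (l + n)%N (2 ^ n * (q l).1 + a)%N (2 ^ n * (q l).2 + b)%N)| <= eps * D.
  move=> an bn; set z := p _ _ _.
  have zc : `|z - c| <= D.
    rewrite (le_trans (ler_distD (c_ l) _ _))//.
    rewrite (_ : D = 2 * C / 2 ^+ l + 2 * C / 2 ^+ l); last by rewrite -mulrDl -mulrDl -natrD.
    by rewrite lerD// ?p_near// distrC.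
  rewrite (_ : h' z = h z - h c - der * (z - c)); last by rewrite /h' /u; ring.
  by rewrite (le_trans (hd _ _))// ?(le_lt_trans zc)// ler_wpM2l// ltW.
have T_le a b : `|h' a| <= eps * D -> `|h' b| <= eps * D -> `|b - a| <= C / 2 ^+ (l + n) ->
    `|trapezoid h' a b| <= 2 * (eps * D) * (C / 2 ^+ (l + n)).
  move=> ha hb ab; rewrite normrM ler_pM// (le_trans (ler_normD _ _))//.
  by rewrite mulrDl mul1r lerD.
(* Replace h by its difference to the affine approximation at c. *)
rewrite /S; under eq_bigr do under eq_bigr do rewrite -(cell_affine h _ _ _ u der).
rewrite -/h' cell_stokes.
have il' a : (a < 2 ^ n)%N -> (2 ^ n * (q l).1 + a < 2 ^ (l + n))%N.
  move=> an; rewrite addnC expnD; have : ((q l).1.+1 * 2 ^ n <= 2 ^ l * 2 ^ n)%N.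
    by rewrite leq_mul2r il orbT.
  by lia.
have il2 a : (a <= 2 ^ n)%N -> (2 ^ n * (q l).1 + a <= 2 ^ (l + n))%N.
  move=> an; rewrite addnC expnD; have : ((q l).1.+1 * 2 ^ n <= 2 ^ l * 2 ^ n)%N.
    by rewrite leq_mul2r il orbT.
  by lia.
pose E := 2 * (eps * D) * (C / 2 ^+ (l + n)).
have side (F : 'I_(2 ^ n) -> K) : (forall a, `|F a| <= 2 * E) ->
    `|\sum_(a < 2 ^ n) F a| <= (2 ^ n)%:R * (2 * E).
  move=> FE; rewrite (le_trans (ler_norm_sum _ _ _))//.
  rewrite mulr_natl -[X in _ *+ X]card_ord -sumr_const; by apply: ler_sum.
have h0 b : (b <= 2 ^ n)%N -> `|h' (p (l + n)%N (2 ^ n * (q l).1)%N (2 ^ n * (q l).2 + b)%N)| <= eps * D.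
  by move=> bn; have := h'_le 0%N b (leq0n _) bn; rewrite addn0.
have h0' a : (a <= 2 ^ n)%N -> `|h' (p (l + n)%N (2 ^ n * (q l).1 + a)%N (2 ^ n * (q l).2)%N)| <= eps * D.
  by move=> an; have := h'_le a 0%N an (leq0n _); rewrite addn0.
apply: (@le_trans _ _ ((2 ^ n)%:R * (2 * E) + (2 ^ n)%:R * (2 * E))).
  rewrite (le_trans (ler_normD _ _))// lerD//.
    apply: side => a; have an := ltn_ord a; rewrite (le_trans (ler_normB _ _))// mulrDl mul1r lerD//;
      apply: T_le; rewrite -?addnS ?h0' ?h'_le// 1?ltnW// addnS p_h// il'//.
  apply: side => a; have an := ltn_ord a; rewrite (le_trans (ler_normB _ _))// mulrDl mul1r lerD//;
      apply: T_le; rewrite -?addnS ?h0 ?h'_le// 1?ltnW// addnS p_v//.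
    by rewrite il2.
  by have := il2 0%N (leq0n _); rewrite addn0.
have -> : (2 ^ n)%:R * (2 * E) + (2 ^ n)%:R * (2 * E) = eta / 4 ^+ l * (C ^+ 2 / (C ^+ 2 + 1)).
  have C1 : C ^+ 2 + 1 != 0 by rewrite gt_eqF// ltr_wpDl// exprn_ge0.
  rewrite /E /eps /D natrX exprD -[4 ^+ l](_ : 2 ^+ l * 2 ^+ l = _); last by rewrite -exprMn -natrM.
  by field; rewrite C1 !expf_neq0 ?pnatr_eq0.
rewrite ler_piMr ?divr_ge0 ?exprn_ge0// ?(ltW eta0)// ler_pdivrMr ?ltr_wpDl ?exprn_ge0//.
by rewrite mul1r lerDl.
Qed.
End discrete_goursat.

(** * The Cauchy formula with finite averages *)

Lemma differentiable_complex (K : numFieldType) (h : K^o -> K^o) (c : K^o) :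
  differentiable h c -> complex_differentiable_at h c.
Proof.
move=> /(@diff_derivable _ _ _ _ _ (1 : K^o)) dh; exists ('D_(1 : K^o) h c) => eps e0.
have : (t^-1 *: ((h \o shift c) (t *: (1 : K^o)) - h c)) @[t --> 0^'] --> 'D_(1 : K^o) h c by exact: dh.
move=> /cvgrPdist_lt/(_ _ e0)[d /= d0 hd]; exists d => // z zc.
have [->|zNc] := eqVneq z c; first by rewrite !subrr mulr0 subrr normr0 mulr0.
have zc0 : z - c != 0 by rewrite subr_eq0.
have := hd (z - c); rewrite /= sub0r normrN => /(_ zc zc0).
rewrite -[(z - c) *: 1]/((z - c) * 1) mulr1 subrK => /ltW hz.
rewrite (_ : _ - _ = - (z - c) * ('D_(1 : K^o) h c - (z - c)^-1 *: (h z - h c))); last first.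
  rewrite (_ : (z - c)^-1 *: (h z - h c) = (z - c)^-1 * (h z - h c))//.
  by field.
by rewrite normrM normrN mulrC ler_wpM2r.
Qed.

Definition entire1 (K : numFieldType) (phi : K -> K) :=
  forall c : K^o, differentiable (phi : K^o -> K^o) c.

Section cauchy.
Context {K : numClosedFieldType}.
Context (archK : archimedean_field K) (ballK : compact_balls K).
Implicit Types phi h : K -> K.

(** Summation by parts around the circle: the two edges at a node combine into one
    term of the average. *)
Lemma trapezoid_circle h (R : K) L :
  \sum_(b < 2 ^ L) trapezoid h (R * omega L ^+ b) (R * omega L ^+ b.+1) =
  2 ^+ L * (omega L - (omega L)^-1) * avg L (fun u => h (R * u) * (R * u)).
Proof.
set v := omega L; have v0 : v != 0 := omega_neq0 L.
pose F b := h (R * v ^+ b) * (R * v ^+ b).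
have shiftF : \sum_(b < 2 ^ L) F b.+1 = \sum_(b < 2 ^ L) F b.
  apply/eqP; rewrite -subr_eq0 -sumrB -(big_mkord xpredT (fun b => F b.+1 - F b)).
  by rewrite telescope_sumr// /F omega_order expr0 subrr.
have N0 : 2 ^+ L != 0 :> K by rewrite expf_neq0 ?pnatr_eq0.
transitivity ((v - 1) * \sum_(b < 2 ^ L) F b + (1 - v^-1) * \sum_(b < 2 ^ L) F b.+1).
  rewrite !mulr_sumr -big_split; apply: eq_bigr => b _ /=.
  by rewrite /trapezoid /F exprS; field; exact: v0.
by rewrite shiftF /avg -/v; field; rewrite N0 v0.
Qed.

(** The quotient (phi z - phi w) / (z - w) is differentiable away from w, and the
    circle of radius R contracts to w along the segments to w. The discrete
    Goursat lemma compares the sums over the first and the last circle of this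
    homotopy; on a small circle around w the sum is small since phi is
    continuous. *)
Lemma cauchy_discrete phi (R w eta : K) : entire1 phi -> `|w| < R -> 0 < eta ->
  exists N, forall L, (N <= L)%N ->
    `|avg L (fun u => (phi (R * u) - phi w) / (R * u - w) * (R * u))| <= eta.
Proof.
move=> dphi wR eta0.
have R0 : 0 < R := le_lt_trans (normr_ge0 _) wR.
have Rw : 0 < R - `|w| by rewrite subr_gt0.
pose eps := eta * (R - `|w|) / (4 * R).
have e0 : 0 < eps by rewrite divr_gt0 ?mulr_gt0.
have : {for (w : K^o), continuous (phi : K^o -> K^o)} by exact: differentiable_continuous.
move=> /cvgrPdist_lt/(_ _ e0)[d /= d0 hd].
have [n hn] := half_pow_small archK (2 * R) d0.
(* The homotopy stops at the fraction t0 of the way, to avoid the singularity at w. *)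
pose t0 : K := 2 ^- n.
have t0_gt0 : 0 < t0 by rewrite invr_gt0 exprn_gt0.
have t0_le1 : t0 <= 1 by rewrite invf_le1 ?exprn_gt0// exprn_ege1// ler1n.
have t0d : t0 * (2 * R) < d by have := hn n (leqnn n); rewrite ger0_norm ?mulr_ge0 ?ltW// mulrC.
pose h z := (phi z - phi w) / (z - w).
pose t L i : K := t0 + (1 - t0) * i%:R / 2 ^+ L.
pose p L i j := w + t L i * (R * omega L ^+ j - w).
have tL L : t L (2 ^ L)%N = 1 by rewrite /t natrX mulfK ?expf_neq0 ?pnatr_eq0// addrC subrK.
have t_ge L i : t0 <= t L i by rewrite lerDl divr_ge0 ?exprn_ge0// mulr_ge0 ?subr_ge0.
have t_le L i : (i <= 2 ^ L)%N -> t L i <= 1.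
  move=> iL; rewrite -(tL L) lerD2l ler_pM2r ?invr_gt0 ?exprn_gt0//.
  by rewrite ler_wpM2l ?subr_ge0// ler_nat.
have t_ge0 L i : 0 <= t L i := le_trans (ltW t0_gt0) (t_ge L i).
have nu L j : `|R * omega L ^+ j| = R.
  by rewrite normrM normrX norm_omega expr1n mulr1 gtr0_norm.
have nuw L j : `|R * omega L ^+ j - w| <= 2 * R.
  by rewrite (le_trans (ler_normB _ _))// nu mulrDl mul1r lerD// ltW.
have nuw_ge L j : R - `|w| <= `|R * omega L ^+ j - w|.
  by rewrite -{1}(nu L j) lerB_dist.
have [||||c hc|N hN] := @discrete_goursat K archK ballK h p (8 * R) (3 * R) _ _ _ _ _ eta eta0.
- move=> L i j; rewrite /p /t exprM omegaS natrM exprS invfM; congr (_ + (_ + _) * _).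
  by field; rewrite expf_neq0 ?pnatr_eq0.
- move=> L i j iL; rewrite (_ : _ - _ = (1 - t0) / 2 ^+ L * (R * omega L ^+ j - w)); last first.
    by rewrite /p /t -natr1; field; rewrite expf_neq0 ?pnatr_eq0.
  rewrite normrM normrM normfV (ger0_norm (exprn_ge0 _ _))// mulrAC ler_pM2r ?invr_gt0 ?exprn_gt0//.
  rewrite ger0_norm ?subr_ge0// (@le_trans _ _ (1 * (2 * R)))//.
    by rewrite ler_pM ?subr_ge0// gerBl ltW.
  by rewrite mul1r ler_pM2r// ler_nat.
- move=> L i j iL; rewrite (_ : _ - _ = t L i * (R * omega L ^+ j) * (omega L - 1)); last first.
    by rewrite /p exprS; ring.
  rewrite normrM normrM nu ger0_norm// (@le_trans _ _ (1 * R * (8 / 2 ^+ L)))//.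
    by rewrite ler_pM ?mulr_ge0 ?(ltW R0) ?norm_omega_sub_le// ler_pM2r// t_le.
  by rewrite mul1r mulrA [R * _]mulrC.
- move=> L i j iL; rewrite (le_trans (ler_normD _ _))// normrM ger0_norm//.
  rewrite (_ : 3 * R = R + 1 * (2 * R)); last by ring.
  by rewrite lerD ?(ltW wR)// ler_pM// t_le.
- apply: differentiable_complex.
  have cw : c - w != 0.
    apply/eqP => cw0; have [L [i [j [iL]]]] := hc _ (mulr_gt0 t0_gt0 Rw).
    rewrite -[c](subrK w) cw0 add0r /p opprD addrA subrr sub0r normrN normrM ger0_norm//.
    by rewrite le_gtF// ler_pM// ltW.
  have dsub (y : K) : differentiable (fun z : K^o => z - y : K^o) c.
    by apply: differentiableB; [exact: ex_diff|exact: differentiable_cst].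
  apply: (@differentiableM _ _ (fun z : K^o => phi z - phi w : K^o) (fun z : K^o => (z - w)^-1 : K^o)).
    by apply: differentiableB; [exact: dphi|exact: differentiable_cst].
  exact: (@differentiableV _ _ (fun z : K^o => z - w : K^o)).
exists N.+2 => -[|[|L]]// NL; have {hN} := hN L.+2 (ltnW (ltnW NL)).
under eq_bigr do under eq_bigr do rewrite -[X in cell _ _ X]add0n -[X in cell _ _ _ X]add0n.
rewrite cell_stokes big1 ?add0r; last first.
  by move=> a _; rewrite !add0n /p omega_order expr0 subrr.
pose g u := h (R * u) * (R * u); rewrite -[avg _ _]/(avg L.+2 g).
under eq_bigr do rewrite !add0n.
rewrite sumrB (_ : \sum_(b < 2 ^ L.+2) _ = 2 ^+ L.+2 * (omega L.+2 - (omega L.+2)^-1) * avg L.+2 g); last first.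
  rewrite /g -trapezoid_circle; apply: eq_bigr => b _.
  by rewrite /p tL !mul1r ![w + _]addrC !subrK.
set inner := \sum_(b < 2 ^ L.+2) _.
have inner_le : `|inner| <= 4 * eta.
  rewrite (le_trans (ler_norm_sum _ _ _))//.
  apply: (@le_trans _ _ (\sum_(b < 2 ^ L.+2) (4 * eta / 2 ^+ L.+2))); last first.
    rewrite sumr_const card_ord -[leLHS]mulr_natr natrX mulfVK//.
    by rewrite expf_neq0 ?pnatr_eq0.
  apply: ler_sum => b _.
  have tE : t L.+2 0%N = t0 by rewrite /t mulr0 mul0r addr0.
  have hp j : `|h (p L.+2 0%N j)| <= eps / (t0 * (R - `|w|)).
    rewrite /h /p tE [w + _]addrC addrK !normrM normfV normrM (gtr0_norm t0_gt0).
    have pos : 0 < t0 * `|R * omega L.+2 ^+ j - w|.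
      by rewrite mulr_gt0// (lt_le_trans Rw).
    rewrite ler_pdivrMr// mulrAC ler_pdivlMr ?mulr_gt0//.
    apply: ler_pM; [by []|by rewrite mulr_ge0 ?ltW| |by rewrite ler_pM2l].
    rewrite distrC; apply/ltW/hd => /=.
    rewrite [_ + w]addrC opprD addrA subrr sub0r normrN normrM gtr0_norm//.
    by rewrite (le_lt_trans _ t0d)// ler_pM2l.
  have -> : 4 * eta / 2 ^+ L.+2 = 2 * (eps / (t0 * (R - `|w|))) * (t0 * (R * (8 / 2 ^+ L.+2))).
    by rewrite /eps; field; rewrite !gt_eqF ?exprn_gt0.
  rewrite normrM; apply: ler_pM => //.
    by rewrite (le_trans (ler_normD _ _))// mulrDl mul1r lerD.
  rewrite (_ : _ - _ = t0 * (R * omega L.+2 ^+ b) * (omega L.+2 - 1)); last first.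
    by rewrite /p tE exprS; ring.
  by rewrite normrM [X in X * _]normrM nu -mulrA (gtr0_norm t0_gt0) !ler_pM2l// norm_omega_sub_le.
move=> hN; set lam := 2 ^+ L.+2 * _ in hN.
(* omega - 1 / omega is (omega^2 - 1) / omega, and omega^2 is the previous root. *)
have lam8 : 8 <= `|lam|.
  rewrite /lam normrM ger0_norm ?exprn_ge0//.
  rewrite (_ : _ - _ = (omega L.+1 - 1) / omega L.+2); last first.
    by rewrite -(omegaS L.+1) mulrBl mul1r expr2 mulfK ?omega_neq0.
  rewrite normrM normfV norm_omega invr1 mulr1 exprS -mulrA.
  have -> : 8 = 2 * 4 :> K by rewrite -natrM.
  by rewrite ler_pM2l// norm_omega_sub_ge.
have : `|lam * avg L.+2 g| <= eta + 4 * eta.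
  by rewrite -[lam * _](subrK inner) (le_trans (ler_normD _ _))// lerD.
rewrite normrM => h5.
have : 8 * `|avg L.+2 g| <= 8 * eta.
  rewrite (@le_trans _ _ (`|lam| * `|avg L.+2 g|))// ?ler_wpM2r// (le_trans h5)//.
  by rewrite -[X in X + _]mul1r -mulrDl ler_pM2r// -[1 + 4]/(1%:R + 4%:R) -natrD ler_nat.
by rewrite ler_pM2l.
Qed.
End cauchy.

(** * Interpolation at roots of unity *)

Lemma eventually_all_lt (P : nat -> nat -> Prop) n :
  (forall j, exists N, forall L, (N <= L)%N -> P j L) ->
  exists N, forall L, (N <= L)%N -> forall j, (j < n)%N -> P j L.
Proof.
move=> h; elim: n => [|n [N hN]]; first by exists 0%N.
have [N' hN'] := h n; exists (maxn N N') => L; rewrite geq_max => /andP[NL N'L] j.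
by rewrite ltnS leq_eqVlt => /predU1P[->|]; [exact: hN'|exact: hN].
Qed.

Section interpolation.
Context {K : numClosedFieldType}.
Implicit Types (phi : K -> K) (z w R : K).

Lemma eq_avg_root n f g : (forall u : K, u ^+ (2 ^ n) = 1 -> f u = g u) -> avg n f = avg n g.
Proof.
move=> fg; congr (_ * _); apply: eq_bigr => j _; apply: fg.
by rewrite -exprM mulnC exprM omega_order expr1n.
Qed.

(** Expand the Cauchy kernel z / (z - R u) into a finite geometric sum, using
    u^(2^L) = 1; averaging then selects one term. *)
Lemma avg_kernel L z R k : R != 0 -> z ^+ (2 ^ L) != R ^+ (2 ^ L) -> (k < 2 ^ L)%N ->
  avg L (fun u => z / (z - R * u) / (R * u) ^+ k) =
  z ^+ (2 ^ L - k) / (z ^+ (2 ^ L) - R ^+ (2 ^ L)).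
Proof.
set N := (2 ^ L)%N => R0 zR kN.
have d0 : z ^+ N - R ^+ N != 0 by rewrite subr_eq0.
transitivity (avg L (fun u => \sum_(l < N)
    (R ^+ l / R ^+ k * z ^+ (N - l) / (z ^+ N - R ^+ N)) * (u ^+ l / u ^+ k))).
  apply: eq_avg_root => u u1.
  have u0 : u != 0 by apply: contra_eq_neq u1 => ->; rewrite expr0n expn_eq0 /= eq_sym oner_eq0.
  have E : z ^+ N - R ^+ N = (z - R * u) * \sum_(l < N) z ^+ (N.-1 - l) * (R * u) ^+ l.
    by rewrite -subrXX exprMn u1 mulr1.
  have zu : z - R * u != 0 by apply: contra d0; rewrite E mulf_eq0 => ->.
  rewrite (_ : z / (z - R * u) = z * (\sum_(l < N) z ^+ (N.-1 - l) * (R * u) ^+ l) / (z ^+ N - R ^+ N)); last first.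
    by rewrite [in RHS]E; field; rewrite zu andbT; move: d0; rewrite E mulf_eq0 negb_or => /andP[].
  rewrite mulr_sumr !mulr_suml; apply: eq_bigr => l _.
  rewrite (_ : (N - l)%N = (N.-1 - l).+1); last by have := ltn_ord l; lia.
  by rewrite exprS !exprMn; field; rewrite d0 !expf_neq0.
rewrite avg_sum (bigD1 (Ordinal kN))//= avgZ avg_mono eqxx mulr1 big1 ?addr0.
  by rewrite divff ?expf_neq0// mul1r.
move=> l lk; rewrite avgZ avg_mono !modn_small//.
by rewrite (_ : (l == k :> nat) = false) ?mulr0//; apply: negbTE.
Qed.

(** The polynomial of degree below 2^L that agrees with [phi] at the 2^L-th roots
    of R^(2^L), written through its discrete Fourier coefficients. *)
Definition interpolation L R phi w : K :=
  \sum_(k < 2 ^ L) avg L (fun u => phi (R * u) / (R * u) ^+ k) * w ^+ k.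

Lemma avgMr n f (c : K) : avg n (fun u => f u * c) = avg n f * c.
Proof. by rewrite /avg -mulrA mulr_suml. Qed.

Lemma avg_exchange n m (G : K -> K -> K) :
  avg n (fun u => avg m (G u)) = avg m (fun v => avg n (G ^~ v)).
Proof.
by rewrite /avg -!mulr_sumr mulrCA exchange_big.
Qed.

Lemma interpolation_avg L R L' (F : K -> K -> K) w :
  interpolation L R (fun v => avg L' (F v)) w = avg L' (fun u => interpolation L R (F ^~ u) w).
Proof.
rewrite /interpolation avg_sum; apply: eq_bigr => k _.
rewrite avgMr -avg_exchange; congr (_ * _).
by congr avg; apply/funext => u; rewrite avgMr.
Qed.

Lemma interpolationB L R f g w :
  interpolation L R (fun v => f v - g v) w = interpolation L R f w - interpolation L R g w.
Proof.
rewrite -sumrB; apply: eq_bigr => k _; rewrite -mulrBl -avgB; congr (_ * _).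
by congr avg; apply/funext => u; rewrite mulrBl.
Qed.

Lemma interpolationZ L R c f w :
  interpolation L R (fun v => c * f v) w = c * interpolation L R f w.
Proof.
rewrite /interpolation mulr_sumr; apply: eq_bigr => k _; rewrite mulrA -avgZ; congr (_ * _).
by congr avg; apply/funext => u; rewrite mulrA.
Qed.

(** On the Cauchy kernel the interpolation error is a closed expression, namely
    the kernel times (w^N - R^N) / (z^N - R^N) with N = 2^L. *)
Lemma interpolation_kernel L R z w : 0 < R -> `|z| = 2 * R -> `|w| <= R ->
  `|z / (z - w) - interpolation L R (fun v => z / (z - v)) w| <= 8 / 2 ^+ (2 ^ L).
Proof.
move=> R0 zR wR; set N := (2 ^ L)%N.
have RN0 : 0 < R ^+ N by rewrite exprn_gt0.
have N2 : 2 <= 2 ^+ N :> K by rewrite -natrX ler_nat (@leq_exp2l 2 1)// expn_gt0.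
have NN2 : 2 ^+ N <= 2 * (2 ^+ N - 1) :> K.
  by rewrite mulrBr mulr1 -subr_ge0 [X in _ <= X](_ : _ = 2 ^+ N - 2) ?subr_ge0//; ring.
have d_ge : R ^+ N * (2 ^+ N - 1) <= `|z ^+ N - R ^+ N|.
  rewrite (le_trans _ (lerB_dist _ _))// !normrX zR (gtr0_norm R0) exprMn.
  by rewrite mulrBr mulr1 [X in X - _]mulrC.
have N1 : 0 < 2 ^+ N - 1 :> K by rewrite subr_gt0 (lt_le_trans _ N2)// ltr1n.
have d0 : z ^+ N - R ^+ N != 0.
  by rewrite -normr_gt0 (lt_le_trans _ d_ge)// mulr_gt0.
have zw_ge : R <= `|z - w|.
  by rewrite (le_trans _ (lerB_dist _ _))// zR lerBrDr mulrDl mul1r lerD2l.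
have zw0 : z - w != 0 by rewrite -normr_gt0 (lt_le_trans R0).
have -> : interpolation L R (fun v => z / (z - v)) w =
    z / (z - w) * ((z ^+ N - w ^+ N) / (z ^+ N - R ^+ N)).
  transitivity (\sum_(k < N) z ^+ (N - k) / (z ^+ N - R ^+ N) * w ^+ k).
    by apply: eq_bigr => k _; rewrite avg_kernel// ?(gt_eqF R0)// -subr_eq0.
  rewrite [z ^+ N - w ^+ N]subrXX (_ : _ / (z - w) * _ = z * (\sum_(i < N) z ^+ (N.-1 - i) * w ^+ i) / (z ^+ N - R ^+ N)); last first.
    by field; rewrite d0.
  rewrite mulr_sumr mulr_suml; apply: eq_bigr => k _.
  rewrite (_ : (N - k)%N = (N.-1 - k).+1); last by have := ltn_ord k; lia.
  by rewrite exprS; field.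
rewrite (_ : _ - _ = z / (z - w) * ((w ^+ N - R ^+ N) / (z ^+ N - R ^+ N))); last first.
  by field; rewrite d0.
rewrite !normrM !normfV zR.
have h1 : 2 * R / `|z - w| <= 2 by rewrite ler_pdivrMr ?ler_pM2l// normr_gt0.
have h2 : `|w ^+ N - R ^+ N| <= 2 * R ^+ N.
  rewrite (le_trans (ler_normB _ _))// mulrDl mul1r !normrX (gtr0_norm R0) lerD2r.
  by rewrite lerXn2r ?nnegrE ?(ltW R0).
apply: (@le_trans _ _ (2 * (2 * R ^+ N / (R ^+ N * (2 ^+ N - 1))))).
  rewrite ler_pM ?divr_ge0 ?mulr_ge0 ?(ltW R0)//.
  rewrite ler_pM ?invr_ge0// lef_pV2// posrE ?mulr_gt0// (lt_le_trans _ d_ge)// mulr_gt0//.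
rewrite (_ : 2 * _ = 4 / (2 ^+ N - 1)); last by field; rewrite !gt_eqF.
rewrite ler_pdivrMr// mulrAC ler_pdivlMr ?exprn_gt0//.
by rewrite (_ : 8 * _ = 4 * (2 * (2 ^+ N - 1))); [rewrite ler_pM2l|ring].
Qed.

Context (archK : archimedean_field K) (ballK : compact_balls K).

Lemma cauchy_formula phi R w eta : entire1 phi -> 0 < R -> `|w| <= R -> 0 < eta ->
  exists N, forall L, (N <= L)%N ->
    `|phi w - avg L (fun u => phi (2 * R * u) * (2 * R * u / (2 * R * u - w)))| <= eta.
Proof.
move=> dphi R0 wR eta0.
have eta2 : 0 < eta / 2 by rewrite divr_gt0.
have wR2 : `|w| < 2 * R by rewrite (le_lt_trans wR)// mulrDl mul1r ltrDl.
have [N hN] := cauchy_discrete archK ballK dphi wR2 eta2.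
have [N' hN'] := half_pow_small archK (2 * phi w) eta2.
exists (maxn N N') => L; rewrite geq_max => /andP[/hN h1 /hN' h2].
have R20 : 2 * R != 0 by rewrite gt_eqF// mulr_gt0.
set M := (2 ^ L)%N.
have LM : 2 ^+ L <= 2 ^+ M :> K by rewrite ler_eXn2l ?ltr1n// ltnW// ltn_expl.
have RM0 : 0 < R ^+ M by rewrite exprn_gt0.
have M2 : 2 <= 2 ^+ M :> K by rewrite -natrX ler_nat (@leq_exp2l 2 1)// expn_gt0.
have M1 : 0 < 2 ^+ M - 1 :> K by rewrite subr_gt0 (lt_le_trans _ M2)// ltr1n.
have d_ge : R ^+ M * (2 ^+ M - 1) <= `|w ^+ M - (2 * R) ^+ M|.
  rewrite distrC (le_trans _ (lerB_dist _ _))// !normrX (gtr0_norm (_ : 0 < 2 * R)) ?mulr_gt0// exprMn.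
  by rewrite mulrBr mulr1 [X in X - _]mulrC lerB// lerXn2r ?nnegrE ?(ltW R0).
have d0 : w ^+ M - (2 * R) ^+ M != 0.
  by rewrite -normr_gt0 (lt_le_trans _ d_ge)// mulr_gt0.
have kappa : avg L (fun u => 2 * R * u / (2 * R * u - w)) = 1 - w ^+ M / (w ^+ M - (2 * R) ^+ M).
  have := @avg_kernel L w (2 * R) 0 R20; rewrite -subr_eq0 d0 expn_gt0 subn0 => /(_ isT isT) <-.
  rewrite -[X in _ = X - _](_ : avg L (fun u => u ^+ 0 / u ^+ 0) = _); last by rewrite avg_mono eqxx.
  rewrite -avgB; apply: eq_avg => u u1; rewrite !expr0 !divr1.
  have zw0 : 2 * R * u - w != 0.
    rewrite -normr_gt0 (lt_le_trans _ (lerB_dist _ _))// subr_gt0 normrM u1 mulr1.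
    by rewrite gtr0_norm ?mulr_gt0.
  have wz0 : w - 2 * R * u != 0 by rewrite -oppr_eq0 opprB.
  by field; rewrite ?zw0 ?wz0.
have kappa_le : `|phi w * (w ^+ M / (w ^+ M - (2 * R) ^+ M))| <= eta / 2.
  apply: le_trans (ltW h2); rewrite normrM [leRHS](_ : _ = `|phi w| * (2 / 2 ^+ L)); last first.
    by rewrite normrM (ger0_norm (ler0n K 2)) mulrA [2 * _]mulrC.
  rewrite ler_wpM2l// normrM normfV normrX (@le_trans _ _ (R ^+ M / (R ^+ M * (2 ^+ M - 1))))//.
    apply: ler_pM; rewrite ?exprn_ge0 ?invr_ge0//.
      by rewrite lerXn2r ?nnegrE ?(ltW R0).
    by rewrite lef_pV2// posrE ?mulr_gt0// normr_gt0.
  rewrite invfM mulrA divff ?gt_eqF// mul1r.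
  rewrite -[leLHS]mul1r ler_pdivrMr// mulrAC ler_pdivlMr ?exprn_gt0// mul1r (le_trans LM)//.
  by rewrite mulrBr mulr1 -subr_ge0 [X in _ <= X](_ : _ = 2 ^+ M - 2) ?subr_ge0//; ring.
rewrite (_ : _ - _ = phi w * (w ^+ M / (w ^+ M - (2 * R) ^+ M))
   - avg L (fun u => (phi (2 * R * u) - phi w) / (2 * R * u - w) * (2 * R * u))); last first.
  have -> : avg L (fun u => (phi (2 * R * u) - phi w) / (2 * R * u - w) * (2 * R * u)) =
     avg L (fun u => phi (2 * R * u) * (2 * R * u / (2 * R * u - w))) - phi w * avg L (fun u => 2 * R * u / (2 * R * u - w)).
    by rewrite -avgZ -avgB; congr avg; apply/funext => u; ring.
  by rewrite kappa; ring.
by rewrite [eta]splitr (le_trans (ler_normB _ _))// lerD.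
Qed.

(** The error at w is a linear functional of finitely many values of [phi], so the
    Cauchy formula, valid at each of these points in the limit, reduces the
    estimate to the Cauchy kernel. *)
Theorem interpolation_error phi R w M L : entire1 phi -> 0 < R -> `|w| <= R ->
  (forall z, `|z| = 2 * R -> `|phi z| <= M) ->
  `|phi w - interpolation L R phi w| <= 8 * M / 2 ^+ (2 ^ L).
Proof.
move=> dphi R0 wR phiM; set N := (2 ^ L)%N.
have M0 : 0 <= M.
  by apply: le_trans (phiM (2 * R) _) => //; rewrite gtr0_norm ?mulr_gt0.
apply: ler_eps; rewrite ?normr_real ?ger0_real ?divr_ge0 ?mulr_ge0 ?exprn_ge0// => eta eta0.
pose eps := eta / N.+1%:R.
have e0 : 0 < eps by rewrite divr_gt0.
(* The points at which the interpolation error samples phi. *)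
pose node j := if (j < N)%N then R * omega L ^+ j else w.
have node_le j : `|node j| <= R.
  rewrite /node; case: ifP => // _.
  by rewrite normrM normrX norm_omega expr1n mulr1 gtr0_norm.
have [N0 hN0] := @eventually_all_lt _ N.+1 (fun j => cauchy_formula dphi R0 (node_le j) e0).
have {hN0} hN := hN0 N0 (leqnn _).
pose psi v := avg N0 (fun u => phi (2 * R * u) * (2 * R * u / (2 * R * u - v))).
pose E v := phi v - psi v.
have -> : phi w - interpolation L R phi w = (E w - interpolation L R E w)
   + (psi w - interpolation L R psi w).
  by rewrite interpolationB /E; ring.
rewrite addrC (le_trans (ler_normD _ _))// lerD//.
  rewrite /psi interpolation_avg -avgB; apply: norm_avg_le => u u1.
  rewrite (interpolationZ _ _ _ (fun v => _ / (_ - v))) -mulrBr normrM.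
  rewrite [leRHS](_ : _ = M * (8 / 2 ^+ N)); last by rewrite mulrA [M * 8]mulrC.
  have nz : `|2 * R * u| = 2 * R by rewrite normrM u1 mulr1 gtr0_norm ?mulr_gt0.
  by apply: ler_pM => //; [exact: phiM|exact: interpolation_kernel].
have Ew : `|E w| <= eps by have := hN N (ltnSn N); rewrite /node ltnn.
have Enode j : (j < N)%N -> `|E (R * omega L ^+ j)| <= eps.
  by move=> jN; have := hN j (ltnW jN); rewrite /node jN.
rewrite (le_trans (ler_normB _ _))// (_ : eta = eps + N%:R * eps); last first.
  by rewrite /eps -natr1; field; rewrite natr1 pnatr_eq0.
rewrite lerD// (le_trans (ler_norm_sum _ _ _))//.
rewrite mulr_natl -[X in _ *+ X]card_ord -sumr_const; apply: ler_sum => k _.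
rewrite normrM normrX (@le_trans _ _ (eps / R ^+ k * R ^+ k))//; last first.
  by rewrite divfK// expf_neq0// gt_eqF.
apply: ler_pM; rewrite ?exprn_ge0//; last by rewrite lerXn2r ?nnegrE ?(ltW R0).
rewrite /avg normrM normfV (ger0_norm (exprn_ge0 _ _))// mulrC ler_pdivrMr ?exprn_gt0//.
rewrite (le_trans (ler_norm_sum _ _ _))//.
rewrite -natrX mulr_natr -[X in _ *+ X]card_ord -sumr_const; apply: ler_sum => j _.
have nR : `|R * omega L ^+ j| = R.
  by rewrite normrM normrX norm_omega expr1n mulr1 gtr0_norm.
rewrite normrM normfV normrX nR.
by rewrite ler_pM2r ?Enode// invr_gt0 exprn_gt0.
Qed.

End interpolation.

(** * Polynomial approximation on polydiscs *)

Section polynomials.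
Context {K : numClosedFieldType} {X : lmodType K}.
Implicit Types (Q : seq (K * (nat -> nat))) (z : nat -> K) (e : nat -> X).

Definition combination e m z : X := \sum_(i < m) z i *: e i.

(** A polynomial in the first [m] coordinates, as a list of coefficients and
    exponents; equal exponents may occur several times. *)
Definition polynomial m Q z : K := \sum_(q <- Q) q.1 * \prod_(i < m) z i ^+ q.2 i.

Definition line_entire (f : X -> K) := forall x v, entire1 (fun t => f (x + t *: v)).

Definition update (T : Type) (a : nat -> T) m (c : T) i := if i == m then c else a i.

Lemma update_eq (T : Type) (a : nat -> T) m c : update a m c m = c.
Proof. by rewrite /update eqxx. Qed.

Lemma prod_update m (z : nat -> K) (a : nat -> nat) k :
  \prod_(i < m.+1) z i ^+ update a m k i = z m ^+ k * \prod_(i < m) z i ^+ a i.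
Proof.
rewrite big_ord_recr /= {2}/update eqxx mulrC; congr (_ * _).
by apply: eq_bigr => i _; rewrite /update ltn_eqF.
Qed.

Context (archK : archimedean_field K) (ballK : compact_balls K).

(** Interpolate in the last coordinate. The coefficients of the interpolating
    polynomial are combinations of the functions f(x + v e_m) for finitely many
    constants v, and these are approximated by induction. *)
Lemma polynomial_approximation (e : nat -> X) m (f : X -> K) :
  line_entire f ->
  (forall R : K, exists B : K, forall z, (forall i, `|z i| <= R) -> `|f (combination e m z)| <= B) ->
  forall R eps : K, 0 < R -> 0 < eps -> exists Q, forall z, (forall i, `|z i| <= R) ->
    `|f (combination e m z) - polynomial m Q z| <= eps.
Proof.
elim: m f => [|m ih] f df fB R eps R0 e0.
  exists [:: (f 0, fun=> 0%N)] => z _.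
  by rewrite /combination /polynomial big_ord0 big_seq1 big_ord0 mulr1 subrr normr0 ltW.
have [B hB] := fB (2 * R).
have R20 : 0 < 2 * R by rewrite mulr_gt0.
have RR2 : R <= 2 * R by rewrite mulrDl mul1r lerDl ltW.
have eps2 : 0 < eps / 2 by rewrite divr_gt0.
have [L hL] := half_pow_small archK (8 * B) eps2.
pose N := (2 ^ L)%N.
have NL : (L <= N)%N by rewrite ltnW// ltn_expl.
have {hL} := hL N NL.
have B0 : 0 <= B.
  by apply: le_trans (hB (fun=> 0) _) => // i; rewrite normr0 ltW.
rewrite ger0_norm ?mulr_ge0// => hL.
pose F j (x : X) := f (x + (R * omega L ^+ j) *: e m).
pose delta := eps / (2 * N%:R).
have N0 : (0 < N)%N by rewrite expn_gt0.
have d0 : 0 < delta by rewrite divr_gt0// mulr_gt0// ltr0n.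
have nR j : `|R * omega L ^+ j| = R.
  by rewrite normrM normrX norm_omega expr1n mulr1 gtr0_norm.
have combS z : combination e m.+1 z = combination e m z + z m *: e m.
  by rewrite /combination big_ord_recr.
have comb_up z c : combination e m (update z m c) = combination e m z.
  by apply: eq_bigr => i _; rewrite /update ltn_eqF.
have approx j : exists Q, forall z, (forall i, `|z i| <= R) ->
    `|F j (combination e m z) - polynomial m Q z| <= delta.
  apply: ih => // [x v c|R'].
    have := df (x + (R * omega L ^+ j) *: e m) v c; rewrite /F.
    by under eq_fun do rewrite addrAC.
  have [B' hB'] := fB (R' + R); exists B' => z zR'.
  have := hB' (update z m (R * omega L ^+ j)); rewrite combS comb_up update_eq; apply.
  move=> i; rewrite /update; case: ifP => _.
    by rewrite nR lerDr (le_trans _ (zR' 0%N)).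
  by rewrite (le_trans (zR' i))// lerDl ltW.
have {approx} /choice[Qf hQ] := approx.
pose c k j : K := (2 ^+ L)^-1 / (R * omega L ^+ j) ^+ k.
exists (flatten [seq [seq (q.1 * c kj.1 kj.2, update q.2 m (kj.1 : nat)) | q <- Qf kj.2]
  | kj : 'I_N * 'I_N <- index_enum ('I_N * 'I_N)%type]) => z zR.
have -> : polynomial m.+1 (flatten [seq [seq (q.1 * c kj.1 kj.2, update q.2 m (kj.1 : nat)) | q <- Qf kj.2]
  | kj : 'I_N * 'I_N <- index_enum ('I_N * 'I_N)%type]) z =
  \sum_(k < N) \sum_(j < N) c k j * polynomial m (Qf j) z * z m ^+ k.
  rewrite /polynomial big_flatten big_map pair_big; apply: eq_bigr => -[k j] _ /=.
  rewrite big_map mulr_sumr mulr_suml; apply: eq_bigr => q _ /=.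
  by rewrite prod_update; ring.
pose phi t := f (combination e m z + t *: e m).
rewrite [eps]splitr combS -/(phi _).
rewrite (le_trans (ler_distD (interpolation L R phi (z m)) _ _))// lerD//.
  apply: le_trans (ltW hL).
  apply: (interpolation_error archK ballK) => //; first exact: df.
  move=> t tR; have := hB (update z m t); rewrite combS comb_up update_eq; apply.
  move=> i; rewrite /update; case: ifP => _; first by rewrite tR.
  by rewrite (le_trans (zR i)).
rewrite /interpolation -sumrB (le_trans (ler_norm_sum _ _ _))//.
rewrite (_ : eps / 2 = \sum_(k < N) delta); last first.
  rewrite sumr_const card_ord -[RHS]mulr_natr /delta; field.
  by rewrite pnatr_eq0 -lt0n N0.
apply: ler_sum => k _.
rewrite -mulr_suml -mulrBl normrM normrX.
rewrite /avg mulr_sumr -sumrB.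
apply: (@le_trans _ _ (delta / R ^+ k * R ^+ k)); last first.
  by rewrite divfK// expf_neq0// gt_eqF.
apply: ler_pM; rewrite ?exprn_ge0//; last by rewrite lerXn2r ?nnegrE ?(ltW R0)//.
rewrite (le_trans (ler_norm_sum _ _ _))//.
rewrite (_ : delta / R ^+ k = \sum_(j < N) (2 ^+ L)^-1 * (delta / R ^+ k)); last first.
  by rewrite sumr_const card_ord -mulrnAl -[_ *+ N]mulr_natr natrX mulVf ?mul1r// expf_neq0 ?pnatr_eq0.
apply: ler_sum => j _.
rewrite (_ : _ - _ = (2 ^+ L)^-1 * ((F j (combination e m z) - polynomial m (Qf j) z) / (R * omega L ^+ j) ^+ k)); last first.
  by rewrite /c /F /phi; ring.
rewrite normrM [X in X * _ <= _]ger0_norm ?invr_ge0 ?exprn_ge0// ler_pM2l ?invr_gt0 ?exprn_gt0//.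
by rewrite normrM normfV normrX nR ler_pM2r ?invr_gt0 ?exprn_gt0// hQ.
Qed.
End polynomials.

(** * Multi-indices, ultralimits and torus averages *)

Lemma mlen_eq0 (be : multiindex) i : (mlen be <= i)%N -> be i = 0%N.
Proof.
move=> bi; apply: fsfun_dflt; apply/negP => ib; move: bi; apply/negP; rewrite -ltnNge.
rewrite /mlen (big_fsetD1 i)//=; exact: leq_maxl.
Qed.

Lemma mlen_leP (be : multiindex) m : (forall i, (m <= i)%N -> be i = 0%N) -> (mlen be <= m)%N.
Proof.
move=> h; rewrite /mlen big_seq; elim/big_ind: _ => // [a b am bm|i]; first by rewrite geq_max am.
by rewrite mem_finsupp; apply: contraNT; rewrite -leqNgt => /h ->.
Qed.

(** Products and sums over the support of a multi-index can be taken over an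
    initial segment of indices, where two multi-indices are easier to compare. *)
Lemma big_finsupp_ord (R : Type) (idx : R) (op : Monoid.com_law idx) (F : nat -> nat -> R)
    (be : multiindex) m : (forall i, F i 0%N = idx) -> (mlen be <= m)%N ->
  \big[op/idx]_(i <- finsupp be) F i (be i) = \big[op/idx]_(i < m) F i (be i).
Proof.
move=> F0 bm; rewrite -(big_mkord xpredT (fun i => F i (be i))).
rewrite [RHS](bigID (fun i => i \in finsupp be)) /= [X in op _ X]big1 ?Monoid.mulm1; last first.
  by move=> i; rewrite memNfinsupp => /eqP ->.
rewrite -[RHS]big_filter; apply: perm_big; apply: uniq_perm; first exact: fset_uniq.
  by rewrite filter_uniq// iota_uniq.
move=> i; rewrite mem_filter mem_index_iota /=; case: (boolP (i \in _)) => //= ib.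
apply/esym; rewrite (leq_trans _ bm)// ltnNge; apply: contraL ib => /mlen_eq0 b0.
by rewrite memNfinsupp b0.
Qed.

Lemma mdegreeE be m : (mlen be <= m)%N -> mdegree be = (\sum_(i < m) be i)%N.
Proof. by move=> bm; rewrite /mdegree (@big_finsupp_ord _ _ addn (fun _ k => k) be m). Qed.

Lemma monomial_funE (K : numFieldType) (X : normedModType K) (e : nat -> X) be m x :
  (mlen be <= m)%N -> monomial_fun e be x = \prod_(i < m) coef e i x ^+ be i.
Proof.
by move=> bm; rewrite /monomial_fun (@big_finsupp_ord _ _ *%R (fun i k => coef e i x ^+ k) be m).
Qed.

Lemma multiindexP m (a : nat -> nat) : exists2 be : multiindex,
  (mlen be <= m)%N & forall i, (i < m)%N -> be i = a i.
Proof.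
pose be : multiindex := [fsfun i in [fset x | x in iota 0 m]%fset => a i | 0%N].
have beE i : be i = if (i < m)%N then a i else 0%N.
  by rewrite fsfunE !inE /= mem_iota /= add0n.
exists be; last by move=> i im; rewrite beE im.
by apply: mlen_leP => i mi; rewrite beE ltnNge mi.
Qed.

Lemma multiindex_eq m (be be' : multiindex) : (mlen be <= m)%N -> (mlen be' <= m)%N ->
  (forall i, (i < m)%N -> be i = be' i) -> be = be'.
Proof.
move=> bm b'm h; apply/fsfunP => i; have [im|mi] := ltnP i m; first exact: h.
by rewrite !mlen_eq0 ?(leq_trans bm) ?(leq_trans b'm).
Qed.

Section ultralimit.

(** Limits along a fixed ultrafilter exist for every bounded sequence of averages,
    so linear functionals can be defined before convergence is known. *)
Definition free_ultrafilter : set_system nat :=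
  projT1 (cid (ultraFilterLemma (eventually_filter))).

Lemma free_ultrafilterP : UltraFilter free_ultrafilter /\ \oo `<=` free_ultrafilter.
Proof. exact: projT2 (cid (ultraFilterLemma (eventually_filter))). Qed.

#[local] Instance free_ultrafilter_ultra : UltraFilter free_ultrafilter := free_ultrafilterP.1.

Lemma fmap_ultrafilter (T U : Type) (F : set_system T) (f : T -> U) :
  UltraFilter F -> UltraFilter (f @ F).
Proof.
move=> FU; split; first exact: fmap_proper_filter.
move=> G GP FG; apply/funext => A; apply/propext; split; last exact: FG.
move=> GA; have [//|nFA] := in_ultra_setVsetC (f @^-1` A) FU.
have : G (~` A) by apply: FG.
by move=> /(filterI GA); rewrite setICr => /filter_not_empty.
Qed.

Context {K : numFieldType}.

Definition ulim (u : nat -> K) : K := lim ((u : nat -> K^o) @ free_ultrafilter).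

Context (ballK : compact_balls K).
Implicit Types (u v : nat -> K) (M : K).

Lemma ulim_cvg u M : (forall n, `|u n| <= M) ->
  (u : nat -> K^o) @ free_ultrafilter --> (ulim u : K^o).
Proof.
move=> uM; pose F : set_system K^o := (u : nat -> K^o) @ free_ultrafilter.
have FU : UltraFilter F by exact: fmap_ultrafilter.
have FM : F [set z : K^o | `|z| <= M].
  by have : free_ultrafilter [set n | `|u n| <= M] by exact: filterE.
have cM : compact [set z : K^o | `|z| <= M] := @ballK M.
move: cM; rewrite compact_ultra => /(_ F FU FM)[l [_ ul]]; exact: (@cvgP _ F l ul).
Qed.

(** The ultrafilter contains all tails, so eventual estimates pass to the
    ultralimit. *)
Lemma ulim_dist u M c eps : (forall n, `|u n| <= M) ->
  (exists N, forall n, (N <= n)%N -> `|u n - c| <= eps) -> `|ulim u - c| <= eps.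
Proof.
move=> uM [N hN]; have e0 : 0 <= eps by apply: le_trans (hN N (leqnn N)).
apply: ler_eps; rewrite ?normr_real ?ger0_real// => eta eta0.
have h1 : free_ultrafilter [set n | `|ulim u - u n| < eta].
  by have /cvgrPdist_lt/(_ _ eta0) := ulim_cvg uM.
have h2 : free_ultrafilter [set n | (N <= n)%N].
  by apply: free_ultrafilterP.2; exists N.
have [n [/= un Nn]] := filter_ex (filterI h1 h2).
by rewrite (le_trans (ler_distD (u n) _ _))// addrC lerD// ?hN// ltW.
Qed.

Lemma ulimB u v M M' : (forall n, `|u n| <= M) -> (forall n, `|v n| <= M') ->
  ulim (fun n => u n - v n) = ulim u - ulim v.
Proof.
move=> uM vM; apply: cvg_lim; first exact: norm_hausdorff.
by apply: cvgB; [exact: ulim_cvg uM|exact: ulim_cvg vM].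
Qed.

Lemma ulim_sum n (F : nat -> nat -> K) M : (forall i k, `|F i k| <= M) ->
  ulim (fun k => \sum_(i < n) F i k) = \sum_(i < n) ulim (F i).
Proof.
move=> FM; apply: cvg_lim; first exact: norm_hausdorff.
elim: n => [|n ih].
  by under eq_fun do rewrite big_ord0; rewrite big_ord0; exact: cvg_cst.
under eq_fun do rewrite big_ord_recr; rewrite big_ord_recr /=.
by apply: cvgD => //; exact: ulim_cvg (FM n).
Qed.

Lemma norm_ulim_le u M : (forall n, `|u n| <= M) -> `|ulim u| <= M.
Proof.
move=> uM; rewrite -[ulim u]subr0; apply: (@ulim_dist _ M) => //.
by exists 0%N => n _; rewrite subr0.
Qed.

End ultralimit.

Section torus_average.
Context {K : numClosedFieldType}.
Implicit Types (G : (nat -> K) -> K) (z : nat -> K) (be : nat -> nat) (M : K).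

(** The average of G(z) z^-be over the torus of 2^L-th roots of unity in the first
    [m] coordinates, the others being 0. *)
Fixpoint torus_avg (L m : nat) be G : K :=
  if m is m'.+1 then
    avg L (fun u => torus_avg L m' be (fun z => G (update z m' u)) / u ^+ be m')
  else G (fun=> 0).

Definition in_torus m z := (forall i, (m <= i)%N -> z i = 0) /\
  (forall i, (i < m)%N -> `|z i| = 1).

Lemma in_torusS m z u : in_torus m z -> `|u| = 1 -> in_torus m.+1 (update z m u).
Proof.
move=> [z0 z1] u1; split=> i; rewrite /update.
  by move=> mi; rewrite gtn_eqF// z0// ltnW.
by rewrite ltnS leq_eqVlt => /predU1P[->|im]; rewrite ?eqxx// ltn_eqF// z1.
Qed.

Lemma norm_torus_avg_le L m be G M : (forall z, in_torus m z -> `|G z| <= M) ->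
  `|torus_avg L m be G| <= M.
Proof.
elim: m G => [|m ih] G GM /=; first by apply: GM; split.
apply: norm_avg_le => u u1; rewrite normrM normfV normrX u1 expr1n divr1.
by apply: ih => z zt; apply: GM; exact: in_torusS.
Qed.

Lemma eq_torus_avg L m be G G' : (forall z, in_torus m z -> G z = G' z) ->
  torus_avg L m be G = torus_avg L m be G'.
Proof.
elim: m G G' => [|m ih] G G' GG' /=; first by apply: GG'; split.
apply: eq_avg => u u1; congr (_ / _); apply: ih => z zt; apply: GG'; exact: in_torusS.
Qed.

Lemma torus_avgB L m be G G' :
  torus_avg L m be (fun z => G z - G' z) = torus_avg L m be G - torus_avg L m be G'.
Proof.
elim: m G G' => [|m ih] G G' //=.
by rewrite -avgB; congr avg; apply/funext => u; rewrite ih mulrBl.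
Qed.

Lemma torus_avg_sum L m be (I : Type) (r : seq I) (c : I -> K) (F : I -> (nat -> K) -> K) :
  torus_avg L m be (fun z => \sum_(i <- r) c i * F i z) = \sum_(i <- r) c i * torus_avg L m be (F i).
Proof.
elim: m F => [|m ih] F //=.
under [RHS]eq_bigr do rewrite -avgZ.
rewrite -avg_sum; congr avg; apply/funext => u.
by rewrite ih mulr_suml; apply: eq_bigr => i _; rewrite mulrA.
Qed.

Lemma torus_avg_monomial L m be (a : nat -> nat) (h : K) :
  (forall i, (i < m)%N -> (be i < 2 ^ L)%N /\ (a i < 2 ^ L)%N) ->
  torus_avg L m be (fun z => h * \prod_(i < m) z i ^+ a i) = h * \prod_(i < m) (a i == be i)%:R.
Proof.
elim: m h => [|m ih] h lt; first by rewrite /= !big_ord0.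
rewrite /= big_ord_recr /= mulrA [RHS](_ : _ =
   avg L (fun u => (h * \prod_(i < m) (a i == be i)%:R) * (u ^+ a m / u ^+ be m))); last first.
  by rewrite avgZ avg_mono !modn_small//; [case: (lt m (ltnSn m))|case: (lt m (ltnSn m))].
congr avg; apply/funext => u.
rewrite [X in X / _](_ : _ = torus_avg L m be (fun z => (h * u ^+ a m) * \prod_(i < m) z i ^+ a i)).
  by rewrite ih; [ring|move=> i im; apply: lt; exact: ltnW].
apply: eq_torus_avg => z _; rewrite big_ord_recr /= update_eq [X in _ * X]mulrC mulrA.
by congr (_ * _); apply: eq_bigr => i _; rewrite /update ltn_eqF.
Qed.

(** For large L a torus average reads off the coefficient of a polynomial exactly.
    The polynomial may have more variables than the torus. *)
Lemma torus_avg_polynomial m n (be : nat -> nat) Q : (m <= n)%N ->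
  (forall i, (m <= i)%N -> be i = 0%N) ->
  exists N, forall L, (N <= L)%N -> torus_avg L m be (polynomial n Q) =
    \sum_(q <- Q) q.1 * \prod_(i < n) (q.2 i == be i)%:R.
Proof.
move=> mn be0; pose N := (\sum_(i < n) be i + \sum_(q <- Q) \sum_(i < n) q.2 i)%N.
exists N => L NL; rewrite torus_avg_sum big_seq [RHS]big_seq; apply: eq_bigr => q qQ.
congr (_ * _).
rewrite (@eq_torus_avg _ _ _ _ (fun z => (\prod_(m <= i < n) (q.2 i == be i)%:R) * \prod_(i < m) z i ^+ q.2 i)).
  rewrite torus_avg_monomial.
    by rewrite mulrC -!(big_mkord xpredT (fun i => (q.2 i == be i)%:R)) -big_cat_nat.
  move=> i im; have i_n := leq_trans im mn; have L2 := ltn_expl L (ltnSn 1).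
  have h1 : (be i <= \sum_(i < n) be i)%N.
    by rewrite (bigD1 (Ordinal i_n))//= leq_addr.
  have h2 : (q.2 i <= \sum_(q <- Q) \sum_(i < n) q.2 i)%N.
    by rewrite (big_rem q)//= (bigD1 (Ordinal i_n))//= -addnA leq_addr.
  by split; apply: leq_ltn_trans L2; apply: leq_trans NL; rewrite /N; lia.
move=> z [z0 _]; rewrite -!(big_mkord xpredT (fun i => z i ^+ q.2 i)).
rewrite (big_cat_nat (n := m))//= mulrC; congr (_ * _).
rewrite big_nat [RHS]big_nat; apply: eq_bigr => i /andP[mi _].
by rewrite z0// be0// expr0n.
Qed.

End torus_average.

(** * Taylor coefficients and homogeneous parts *)

Lemma sum_geometric_tail (K : numFieldType) (D n : nat) :
  \sum_(D <= d < n) (2 ^- d : K) <= 2 / 2 ^+ D.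
Proof.
have [nD|/ltnW/subnKC <-] := leqP n D.
  by rewrite big_geq// divr_ge0// exprn_ge0.
move: (n - D)%N => k; apply: (@le_trans _ _ (2 / 2 ^+ D - 2 / 2 ^+ (D + k))); last first.
  by rewrite gerBl divr_ge0 ?exprn_ge0.
elim: k => [|k ih]; first by rewrite addn0 big_geq// subrr.
rewrite addnS big_nat_recr ?leq_addr//= (le_trans (lerD ih (lexx _)))//.
rewrite exprS le_eqVlt; apply/orP; left; apply/eqP.
by field; rewrite !expf_neq0 ?pnatr_eq0.
Qed.

Section taylor.
Context {K : numClosedFieldType} {X : normedModType K}.
Context (archK : archimedean_field K) (ballK : compact_balls K).
Implicit Types (e : nat -> X) (f : X -> K) (be : multiindex).

Definition polydisc e m (R : K) : set X :=
  [set x | exists2 z : nat -> K, (forall i, `|z i| <= R) & combination e m z = x].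

Lemma polydisc_compact e m (R : K) : compact (polydisc e m R).
Proof.
rewrite /polydisc.
have [R0|nR0] := boolP (0 <= R); last first.
  rewrite (_ : [set _ | _] = set0) ?eqEsubset; first exact: compact0.
  by split=> // x [z /(_ 0%N)/(le_trans (normr_ge0 _))]; rewrite (negPf nR0).
elim: m => [|m ih].
  rewrite (_ : [set _ | _] = [set 0]); first exact: compact_set1.
  apply/seteqP; split => [x [z _ <-]|x ->]; first by rewrite /combination big_ord0.
  by exists (fun=> 0) => [i|]; rewrite ?normr0// /combination big_ord0.
set A := [set _ | _] in ih.
pose F (p : X * K^o) : X := p.1 + p.2 *: e m.
have cF : continuous F.
  move=> p; apply: (@cvgD _ _ _ _ _ (fun p : X * K^o => p.1) (fun p => p.2 *: e m)).
    exact: cvg_fst.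
  by apply: cvgZr_tmp; exact: cvg_snd.
rewrite (_ : [set _ | _] = F @` (A `*` [set t : K^o | `|t| <= R])).
  apply: continuous_compact; first exact: continuous_subspaceT.
  by apply: compact_setX; [exact: ih|exact: ballK].
apply/seteqP; split=> [x [z zR <-]|_ [[y t] [/= [z zR <-] tR] <-]] /=.
  exists (combination e m z, z m); last by rewrite /F /combination big_ord_recr.
  by split => /=; [exists z|exact: zR].
exists (update z m t) => [i|]; first by rewrite /update; case: ifP.
rewrite /F /combination big_ord_recr /= update_eq; congr (_ + _).
by apply: eq_bigr => i _; rewrite /update ltn_eqF.
Qed.

Definition polydisc_bounded f := forall e m (R : K), exists B : K,
  forall z : nat -> K, (forall i, `|z i| <= R) -> `|f (combination e m z)| <= B.

(** The Cauchy integral for the Taylor coefficient of [f] with index [be]. *)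
Definition coefficient e f be : K :=
  ulim (fun L => torus_avg L (mlen be) be (fun z => f (combination e (mlen be) z))).

(** The degree [d] Taylor part of [f]. Using the circle of radius 4 builds the
    factor 4^-d of the Cauchy estimate into the definition. *)
Definition homogeneous_part f d x : K :=
  ulim (fun L => avg L (fun u => f ((4 * u) *: x) / (4 * u) ^+ d)).

Lemma in_torus_le m (z : nat -> K) i : in_torus m z -> `|z i| <= 1.
Proof.
move=> [z0 z1]; have [im|mi] := ltnP i m; first by rewrite z1.
by rewrite z0// normr0.
Qed.

Lemma combination_widen e m n (z : nat -> K) : (m <= n)%N -> (forall i, (m <= i)%N -> z i = 0) ->
  combination e n z = combination e m z.
Proof.
move=> mn z0; rewrite /combination -!(big_mkord xpredT (fun i => z i *: e i)).
rewrite (big_cat_nat (n := m))//= [X in _ + X]big_nat [X in _ + X]big1 ?addr0// => i /andP[mi _].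
by rewrite z0// scale0r.
Qed.

Lemma combinationZ e m (z : nat -> K) c :
  c *: combination e m z = combination e m (fun i => c * z i).
Proof. by rewrite scaler_sumr; apply: eq_bigr => i _; rewrite scalerA. Qed.

(** An approximation of [f] on the torus of the variables of [be] is enough, even
    if the approximating polynomial depends on more variables. *)
Lemma coefficient_dist e f be n Q (eps : K) : polydisc_bounded f -> (mlen be <= n)%N ->
  (forall z, in_torus (mlen be) z -> `|f (combination e n z) - polynomial n Q z| <= eps) ->
  `|coefficient e f be - \sum_(q <- Q) q.1 * \prod_(i < n) (q.2 i == be i)%:R| <= eps.
Proof.
move=> fB bn fQ; have [B hB] := fB e (mlen be) 1.
have comb z : in_torus (mlen be) z -> combination e n z = combination e (mlen be) z.
  by move=> [z0 _]; exact: combination_widen.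
apply: (ulim_dist ballK (M := B)) => [L|].
  by apply: norm_torus_avg_le => z zt; apply: hB => i; exact: in_torus_le zt.
have [N hN] := torus_avg_polynomial Q bn (@mlen_eq0 be).
exists N => L /hN <-; rewrite -torus_avgB; apply: norm_torus_avg_le => z zt.
by rewrite -comb//; exact: fQ.
Qed.

Lemma coefficient_sub e f g be (eps : K) : polydisc_bounded f -> polydisc_bounded g ->
  (forall z, in_torus (mlen be) z ->
     `|f (combination e (mlen be) z) - g (combination e (mlen be) z)| <= eps) ->
  `|coefficient e f be - coefficient e g be| <= eps.
Proof.
move=> fB gB fg; have [B hB] := fB e (mlen be) 1; have [B' hB'] := gB e (mlen be) 1.
rewrite /coefficient -(ulimB ballK (M := B) (M' := B')); last 2 first.
- by move=> L; apply: norm_torus_avg_le => z zt; apply: hB => i; exact: in_torus_le zt.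
- by move=> L; apply: norm_torus_avg_le => z zt; apply: hB' => i; exact: in_torus_le zt.
apply: (norm_ulim_le ballK) => L; rewrite -torus_avgB; exact: norm_torus_avg_le.
Qed.

Lemma avg_polynomial n Q d (z : nat -> K) (R : K) : R != 0 -> exists N, forall L, (N <= L)%N ->
  avg L (fun u => polynomial n Q (fun i => R * u * z i) / (R * u) ^+ d) =
  \sum_(q <- Q | (\sum_(i < n) q.2 i == d)%N) q.1 * \prod_(i < n) z i ^+ q.2 i.
Proof.
move=> R0; exists (d + \sum_(q <- Q) \sum_(i < n) q.2 i)%N => L NL.
transitivity (\sum_(q <- Q) (q.1 * \prod_(i < n) z i ^+ q.2 i * (R ^+ (\sum_(i < n) q.2 i) / R ^+ d))
   * avg L (fun u => u ^+ (\sum_(i < n) q.2 i) / u ^+ d)).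
  under [RHS]eq_bigr do rewrite -avgZ.
  rewrite -avg_sum; apply: eq_avg => u u1; rewrite mulr_suml; apply: eq_bigr => q _.
  have -> : \prod_(i < n) (R * u * z i) ^+ q.2 i =
      (R * u) ^+ (\sum_(i < n) q.2 i) * \prod_(i < n) z i ^+ q.2 i.
    by rewrite -prodrXr -big_split; apply: eq_bigr => i _; rewrite exprMn.
  have u0 : u != 0 by rewrite -normr_gt0 u1.
  by rewrite !exprMn; field; rewrite !expf_neq0.
rewrite [RHS]big_mkcond big_seq [RHS]big_seq; apply: eq_bigr => q qQ.
have qle : (\sum_(i < n) q.2 i <= \sum_(q <- Q) \sum_(i < n) q.2 i)%N.
  by rewrite [leqRHS](big_rem q)//= leq_addr.
have L2 := ltn_expl L (ltnSn 1).
have dL : (d < 2 ^ L)%N by lia.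
have qL : (\sum_(i < n) q.2 i < 2 ^ L)%N by lia.
rewrite avg_mono !modn_small//.
case: eqP => [->|_]; last by rewrite mulr0.
by rewrite divff ?expf_neq0// !mulr1.
Qed.

Lemma norm_homogeneous_seq_le f d x (G : K) : (forall u : K, `|u| = 1 -> `|f ((4 * u) *: x)| <= G) ->
  forall L, `|avg L (fun u => f ((4 * u) *: x) / (4 * u) ^+ d)| <= G / 4 ^+ d.
Proof.
move=> fG L; apply: norm_avg_le => u u1.
rewrite normrM normfV normrX normrM u1 mulr1 (ger0_norm (ler0n K 4)).
by rewrite ler_pM2r ?fG// invr_gt0 exprn_gt0.
Qed.

Lemma circle_bounded f x : polydisc_bounded f -> exists B : K,
  forall u : K, `|u| <= 8 -> `|f (u *: x)| <= B.
Proof.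
move=> fB; have [B hB] := fB (fun=> x) 1%N 8; exists B => u u8.
by have := hB (fun=> u) (fun=> u8); rewrite /combination big_ord1.
Qed.

Lemma circle_bounded4 f x : polydisc_bounded f -> exists B : K,
  forall u : K, `|u| = 1 -> `|f ((4 * u) *: x)| <= B.
Proof.
move=> fB; have [B hB] := circle_bounded x fB; exists B => u u1; apply: hB.
by rewrite normrM u1 mulr1 ger0_norm// ler_nat.
Qed.

Lemma homogeneous_part_le f d x (G : K) : (forall u : K, `|u| = 1 -> `|f ((4 * u) *: x)| <= G) ->
  `|homogeneous_part f d x| <= G / 4 ^+ d.
Proof. by move=> fG; apply: (norm_ulim_le ballK); exact: norm_homogeneous_seq_le. Qed.

Lemma homogeneous_part_sub f d x y (eps : K) : polydisc_bounded f ->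
  (forall u : K, `|u| = 1 -> `|f ((4 * u) *: x) - f ((4 * u) *: y)| <= eps) ->
  `|homogeneous_part f d x - homogeneous_part f d y| <= eps / 4 ^+ d.
Proof.
move=> fB fxy; have [B hB] := circle_bounded4 x fB; have [B' hB'] := circle_bounded4 y fB.
rewrite /homogeneous_part -(ulimB ballK (norm_homogeneous_seq_le d hB) (norm_homogeneous_seq_le d hB')).
apply: (norm_ulim_le ballK) => L; rewrite -avgB; apply: norm_avg_le => u u1.
rewrite -mulrBl normrM normfV normrX normrM u1 mulr1 (ger0_norm (ler0n K 4)).
by rewrite ler_pM2r ?fxy// invr_gt0 exprn_gt0.
Qed.

Lemma homogeneous_part_dist e f n d Q (z : nat -> K) (eps : K) : polydisc_bounded f ->
  (forall u : K, `|u| = 1 -> `|f (combination e n (fun i => 4 * u * z i)) -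
     polynomial n Q (fun i => 4 * u * z i)| <= eps) ->
  `|homogeneous_part f d (combination e n z) -
     \sum_(q <- Q | (\sum_(i < n) q.2 i == d)%N) q.1 * \prod_(i < n) z i ^+ q.2 i| <= eps.
Proof.
move=> fB fQ; have [B hB] := circle_bounded4 (combination e n z) fB.
apply: (ulim_dist ballK (norm_homogeneous_seq_le d hB)).
have [|N hN] := avg_polynomial n Q d z (R := 4); first by rewrite pnatr_eq0.
exists N => L /hN <-; rewrite -avgB; apply: norm_avg_le => u u1.
rewrite -mulrBl combinationZ normrM normfV normrX normrM u1 mulr1 (ger0_norm (ler0n K 4)).
have h := fQ u u1; rewrite (le_trans _ h)// ler_piMr// invf_le1 ?exprn_gt0//.
by rewrite exprn_ege1// ler1n.
Qed.

(** The interpolation polynomial at 1 of t |-> f(t x) on the circle of radius 4 is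
    the sum of all the averages that define the homogeneous parts; all but the
    first D of them are dominated by a geometric series. *)
Lemma homogeneous_part_sum f x D (G : K) : line_entire f ->
  polydisc_bounded f -> (forall u : K, `|u| = 1 -> `|f ((4 * u) *: x)| <= G) ->
  `|f x - \sum_(d < D) homogeneous_part f d x| <= 2 * G / 2 ^+ D.
Proof.
move=> df fB fG; have [B hB] := circle_bounded x fB.
have G0 : 0 <= G by apply: le_trans (fG 1 (normr1 _)).
have B0 : 0 <= B by apply: le_trans (hB 0 _); rewrite ?normr0.
pose A L k := avg L (fun u => f ((4 * u) *: x) / (4 * u) ^+ k).
have A_le k L : `|A L k| <= G / 4 ^+ k := norm_homogeneous_seq_le k fG L.
have A_leG k L : `|A L k| <= G.
  by rewrite (le_trans (A_le k L))// ler_piMr// invf_le1 ?exprn_gt0// exprn_ege1// ler1n.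
rewrite /homogeneous_part -(ulim_sum ballK D (F := fun k L => A L k) (M := G))// distrC.
apply: ler_eps; rewrite ?normr_real ?ger0_real ?divr_ge0 ?mulr_ge0 ?exprn_ge0// => eps e0.
apply: (ulim_dist ballK (M := \sum_(k < D) G)) => [L|].
  by rewrite (le_trans (ler_norm_sum _ _ _))//; apply: ler_sum.
have [N hN] := half_pow_small archK (8 * B) e0.
exists (N + D)%N => L NL; rewrite distrC.
have L2 := ltn_expl L (ltnSn 1).
have interpE : interpolation L 4 (fun t => f (0 + t *: x)) 1 = \sum_(k < 2 ^ L) A L k.
  apply: eq_bigr => k _; rewrite expr1n mulr1 /A; congr avg.
  by apply/funext => u; rewrite add0r.
rewrite (le_trans (ler_distD (interpolation L 4 (fun t => f (0 + t *: x)) 1) _ _))// addrC lerD//.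
  rewrite interpE -(subnKC (_ : D <= 2 ^ L)%N); last by lia.
  rewrite -!(big_mkord xpredT (A L)) (big_cat_nat (n := D))//= ?leq_addr//.
  rewrite addrAC subrr add0r.
  rewrite (le_trans (ler_norm_sum _ _ _))//.
  apply: (@le_trans _ _ (\sum_(D <= k < D + (2 ^ L - D)) G * 2 ^- k)).
    apply: ler_sum => k _; rewrite (le_trans (A_le k L))// ler_wpM2l//.
    by rewrite lef_pV2 ?posrE ?exprn_gt0// lerXn2r ?nnegrE// ler_nat.
  by rewrite -mulr_sumr [2 * G]mulrC -mulrA ler_wpM2l// sum_geometric_tail.
rewrite -{1}[x]scale1r -[1 *: x]add0r.
have := hN (2 ^ L)%N; rewrite ger0_norm ?mulr_ge0// => h.
apply: le_trans (ltW (h _)); last by lia.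
apply: (interpolation_error archK ballK (phi := fun t => f (0 + t *: x)) (R := 4)) => //.
  by rewrite normr1 ler1n.
by move=> u u8; rewrite add0r; apply: hB; rewrite u8 -natrM.
Qed.

(** Both sides are bounded by a constant times the supremum of |f| on a polydisc,
    and they agree for polynomials, which approximate [f] there. The list [r]
    enumerates the multi-indices of degree [d] in the first [n] variables. *)
Lemma homogeneous_part_expansion e f n d (z : nat -> K) (r : seq multiindex) :
  line_entire f -> polydisc_bounded f ->
  uniq r -> (forall be, be \in r <-> (mlen be <= n)%N /\ mdegree be = d) ->
  homogeneous_part f d (combination e n z) =
  \sum_(be <- r) coefficient e f be * \prod_(i < n) z i ^+ be i.
Proof.
move=> df fB ur rP; apply/eqP; rewrite -subr_eq0 -normr_le0; apply: ler_eps;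
  rewrite ?normr_real ?real0// => eta eta0; rewrite add0r.
(* The weight with which an approximation error enters the difference of the sides. *)
pose W := 1 + \sum_(be <- r) `|\prod_(i < n) z i ^+ be i|.
have W0 : 0 < W by rewrite ltr_wpDr// sumr_ge0.
pose eps := eta / W; have e0 : 0 < eps by rewrite divr_gt0.
pose R := 1 + 4 * \sum_(i < n) `|z i|.
have R1 : 1 <= R by rewrite lerDl mulr_ge0// sumr_ge0.
have zR (i : 'I_n) : 4 * `|z i| <= R.
  rewrite ler_wpDl// ler_pM2l// (bigD1 i)//= lerDl sumr_ge0//.
have [Q hQ] := polynomial_approximation archK ballK (m := n) df (fB e n) (lt_le_trans ltr01 R1) e0.
pose S := \sum_(q <- Q | (\sum_(i < n) q.2 i == d)%N) q.1 * \prod_(i < n) z i ^+ q.2 i.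
pose a be := \sum_(q <- Q) q.1 * \prod_(i < n) (q.2 i == be i)%:R : K.
have SE : S = \sum_(be <- r) a be * \prod_(i < n) z i ^+ be i.
  under eq_bigr do rewrite /a mulr_suml.
  rewrite exchange_big /S big_mkcond; apply: eq_bigr => q _ /=.
  have [be0 be0n be0E] := multiindexP n q.2.
  have deg0 : mdegree be0 = (\sum_(i < n) q.2 i)%N.
    by rewrite (mdegreeE be0n); apply: eq_bigr => i _; rewrite be0E.
  have other be : be \in r -> be != be0 -> \prod_(i < n) (q.2 i == be i)%:R = 0 :> K.
    move=> /rP[ben _] ne; apply/eqP/prodf_eq0.
    have [i /negPf ni] : exists i : 'I_n, q.2 i != be i; last by exists i => //; rewrite ni.
    apply: contrapT => h; move/eqP: ne; apply; apply: (multiindex_eq ben be0n) => i im.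
    rewrite be0E//; apply: contrapT => /eqP qi; apply: h; exists (Ordinal im).
    by rewrite eq_sym.
  case: ifP => [/eqP qd|/eqP qd].
    have be0r : be0 \in r by apply/rP; rewrite deg0.
    rewrite (bigD1_seq be0)//= [X in _ = _ + X](_ : _ = 0) ?addr0; last first.
      by rewrite big_seq_cond big1// => be /andP[br ne]; rewrite other// mulr0 mul0r.
    rewrite [X in _ * X * _]big1 ?mulr1; last by move=> i _; rewrite be0E// eqxx.
    by congr (_ * _); apply: eq_bigr => i _; rewrite be0E.
  rewrite big_seq big1// => be br; rewrite other ?mulr0 ?mul0r//.
  by apply/eqP => bE; apply: qd; rewrite -deg0 -bE; have [_] := (rP be).1 br.
rewrite (le_trans (ler_distD S _ _))//.
have -> : eta = eps + eps * \sum_(be <- r) `|\prod_(i < n) z i ^+ be i|.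
  by rewrite -[X in X + _]mulr1 -mulrDr -/W /eps divfK// gt_eqF.
rewrite lerD//.
  pose z' i := if (i < n)%N then z i else 0.
  have -> : combination e n z = combination e n z'.
    by apply: eq_bigr => i _; rewrite /z' ltn_ord.
  rewrite (_ : S = \sum_(q <- Q | (\sum_(i < n) q.2 i == d)%N) q.1 * \prod_(i < n) z' i ^+ q.2 i); last first.
    by apply: eq_bigr => q _; congr (_ * _); apply: eq_bigr => i _; rewrite /z' ltn_ord.
  apply: homogeneous_part_dist => // u u1; apply: hQ => i.
  rewrite normrM normrM u1 mulr1 ger0_norm// /z'; case: ltnP => [im|_].
    exact: (zR (Ordinal im)).
  by rewrite normr0 mulr0 (le_trans _ R1).
rewrite SE -sumrB (le_trans (ler_norm_sum _ _ _))// mulr_sumr big_seq [leRHS]big_seq.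
apply: ler_sum => be br; rewrite -mulrBl normrM ler_wpM2r// distrC.
have [ben _] := (rP be).1 br.
apply: coefficient_dist => // w wt; apply: hQ => i; exact: le_trans (in_torus_le i wt) R1.
Qed.

End taylor.

(** * Compactness, completeness and uniform boundedness *)

(** Finite subcovers in the form used throughout: a property that eventually holds
    near each point of a compact set eventually holds on all of it. *)
Lemma compact_eventually (T : topologicalType) (A : set T) (P : nat -> T -> Prop) : compact A ->
  (forall x, A x -> exists N, \forall x' \near x, forall n, (N <= n)%N -> P n x') ->
  exists N, forall n, (N <= n)%N -> forall x, A x -> P n x.
Proof.
move=> /compact_near_coveringP cA AP.
have [|N _ hN] := cA nat \oo P _; last by exists N => n /hN.
move=> x /AP[N Nx]; exists ([set x' | forall n, (N <= n)%N -> P n x'], [set n | (N <= n)%N]).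
  by split => //; exists N.
by move=> [x' n] [/= h1 h2]; exact: h1.
Qed.

Lemma compact_norm_bounded (K : numFieldType) (T : topologicalType) (A : set T) (g : T -> K) :
  archimedean_field K -> compact A -> (forall x : T, (g x' : K^o) @[x' --> x] --> (g x : K^o)) ->
  exists B : K, forall x, A x -> `|g x| <= B.
Proof.
move=> archK cA cg.
have [|N hN] := @compact_eventually T A (fun n x => `|g x| <= n%:R) cA; last first.
  by exists N%:R; exact: hN.
move=> x0 _; have [N hN] := archK (`|g x0| + 1); exists N.
have /cvgrPdist_lt/(_ _ ltr01) := cg x0; apply: filterS => x /= xx0 n Nn.
have : `|g x0| + 1 <= n%:R.
  rewrite (@le_trans _ _ N%:R) ?ler_nat// ltW//.
  by move: hN; rewrite [X in X < _]ger0_norm// addr_ge0.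
apply: le_trans; rewrite -lerBlDl ltW// (le_lt_trans _ xx0)//.
by rewrite distrC lerB_dist.
Qed.

Lemma cauchy_tail_cvg (K : numFieldType) (V : completeNormedModType K) (u : nat -> V) :
  (forall eps : K, 0 < eps -> exists N, forall n, (N <= n)%N -> `|u n - u N| <= eps) ->
  exists l : V, u @ \oo --> l.
Proof.
move=> h; suff /cauchy_cvgP : cauchy (u @ \oo) by move=> ul; exists (lim (u @ \oo)).
apply: cauchy_exP => eps e0; have [N hN] := h (eps / 2) (divr_gt0 e0 (ltr0n K 2)).
exists (u N), N => // n /= Nn; rewrite -ball_normE /= distrC (le_lt_trans (hN n Nn))//.
by rewrite ltr_pdivrMr// ltr_pMr// ltr1n.
Qed.

Section uniform_boundedness.
Context {K : numFieldType} (archK : archimedean_field K).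

(** The Banach-Steinhaus theorem over a partially ordered scalar field. If no
    uniform bound exists, every ball contains a smaller ball on which some [T i]
    exceeds a prescribed integer; a common point of a nested sequence of such
    balls contradicts pointwise boundedness. *)
Lemma uniform_boundedness (V : completeNormedModType K) (W : normedModType K)
    (I : Type) (T : I -> V -> W) :
  (forall i, linear (T i)) -> (forall i, continuous (T i)) ->
  (forall x, exists B : K, forall i, `|T i x| <= B) ->
  exists2 C : K, 0 < C & forall i x, `|T i x| <= C * `|x|.
Proof.
move=> Tl Tc Tb; apply: contrapT => nC.
have T0 i : T i 0 = 0.
  by have := Tl i (-1) 0 0; rewrite scaler0 addr0 scaleN1r addNr.
have TB i x y : T i (x - y) = T i x - T i y.
  by rewrite -[x - y](addrC (- y)) -scaleN1r Tl scaleN1r addrC.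
have TZ i c x : T i (c *: x) = c *: T i x by rewrite -[c *: x]addr0 Tl T0 addr0.
have escape x (r : K) n : 0 < r -> exists i y, `|y - x| <= r /\ n%:R < `|T i y|.
  move=> r0; apply: contrapT => nesc; apply: nC.
  have le i y : `|y - x| <= r -> `|T i y| <= n%:R.
    move=> yx; rewrite real_leNgt// ?realn//; apply/negP => ny; apply: nesc.
    by exists i, y.
  exists (2 * n%:R / r + 1); first by rewrite ltr_wpDl// divr_ge0 ?mulr_ge0// ltW.
  move=> i z; have [->|z0] := eqVneq z 0; first by rewrite T0 !normr0 mulr0.
  have nz : 0 < `|z| by rewrite normr_gt0.
  pose z' := (r / `|z|) *: z.
  have zz' : z = (`|z| / r) *: z'.
    by rewrite scalerA mulrACA [_^-1 * _]mulrC -mulrACA !divff ?mulr1 ?scale1r ?gt_eqF.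
  have nz' : `|T i z'| <= 2 * n%:R.
    rewrite -[z'](addrK x) TB (le_trans (ler_normB _ _))// mulrDl mul1r lerD// le//.
      rewrite addrK /z' normrZ ger0_norm ?divr_ge0 ?(ltW r0)//.
      by rewrite divfK ?gt_eqF.
    by rewrite subrr normr0 ltW.
  rewrite {1}zz' TZ normrZ ger0_norm ?divr_ge0//; last exact: ltW.
  rewrite (@le_trans _ _ (`|z| / r * (2 * n%:R)))// ?ler_wpM2l ?divr_ge0 ?(ltW r0)//.
  by rewrite [leLHS]mulrC [leLHS]mulrA [leLHS]mulrAC [leRHS]mulrDl mul1r lerDl.
have step (xr : V * K) n : exists xr' : V * K, 0 < xr.2 ->
    [/\ 0 < xr'.2, xr'.2 <= xr.2 / 2, `|xr'.1 - xr.1| + xr'.2 <= xr.2 &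
      exists i, forall y, `|y - xr'.1| <= xr'.2 -> n%:R < `|T i y|].
  case: xr => x r /=; have [r0|] := pselect (0 < r); last by exists (0, 0).
  have r20 : 0 < r / 2 by rewrite divr_gt0.
  have [i [y [yx ny]]] := escape x _ n r20.
  have cTy : `|T i z| @[z --> y] --> `|T i y| by apply: cvg_norm; exact: Tc.
  have d0 : 0 < `|T i y| - n%:R by rewrite subr_gt0.
  move/cvgrPdist_lt: cTy => /(_ _ d0)/nbhs_ballP[d /= d0' hd].
  have d20 : 0 < d / 2 by rewrite divr_gt0.
  have cmp : d / 2 >=< r / 2 by apply: real_comparable; rewrite gtr0_real.
  exists (y, Num.min (d / 2) (r / 2)) => _ /=.
  have mr : Num.min (d / 2) (r / 2) <= r / 2 by rewrite comparable_ge_min// lexx orbT.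
  have md : Num.min (d / 2) (r / 2) <= d / 2 by rewrite comparable_ge_min// lexx.
  split => //; first by rewrite comparable_lt_min// d20.
    by rewrite [leRHS]splitr lerD.
  exists i => z zy; have : ball y d z.
    rewrite -ball_normE /= distrC (le_lt_trans zy)// (le_lt_trans md)//.
    by rewrite ltr_pdivrMr// ltr_pMr// ltr1n.
  move=> /hd /= h; have := le_lt_trans (real_ler_norm _) h.
  by rewrite realB ?normr_real// ltrD2l ltrN2; apply.
have /choice[g gP] : forall x : nat * (V * K), exists xr' : V * K, 0 < x.2.2 ->
    [/\ 0 < xr'.2, xr'.2 <= x.2.2 / 2, `|xr'.1 - x.2.1| + xr'.2 <= x.2.2 &
      exists i, forall y, `|y - xr'.1| <= xr'.2 -> x.1%:R < `|T i y|].
  by move=> [n xr]; exact: step.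
pose q := fix q n := if n is n'.+1 then g (n', q n') else (0, 1 : K).
have q0 n : 0 < (q n).2.
  elim: n => [|n ih]; first exact: ltr01.
  by have [] := gP (n, q n) ih.
have q2 n : (q n).2 <= 1 / 2 ^+ n.
  elim: n => [|n ih]; first by rewrite expr0 divr1.
  have [_ h _ _] := gP (n, q n) (q0 n); rewrite (le_trans h)// exprSr invfM mulrA.
  by rewrite ler_pM2r ?invr_gt0.
have q_near n k : `|(q (n + k)%N).1 - (q n).1| + (q (n + k)%N).2 <= (q n).2.
  elim: k => [|k ih]; first by rewrite addn0 subrr normr0 add0r.
  have [_ _ h _] := gP ((n + k)%N, q (n + k)%N) (q0 (n + k)%N).
  rewrite addnS; apply: le_trans ih; apply: le_trans (lerD (lexx _) h).
  by rewrite addrA lerD2r [leRHS]addrC ler_distD.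
have q_le n k : `|(q (n + k)%N).1 - (q n).1| <= (q n).2.
  by apply: le_trans (q_near n k); rewrite lerDl ltW.
have [|x qx] := @cauchy_tail_cvg K V (fun n => (q n).1).
  move=> eps e0; have [N hN] := half_pow_small archK 1 e0; exists N => n Nn.
  rewrite -(subnKC Nn) (le_trans (q_le _ _))// (le_trans (q2 _))// ltW//.
  by have := hN N (leqnn _); rewrite normr1.
have xq n : `|x - (q n).1| <= (q n).2.
  apply: ler_eps; rewrite ?normr_real ?gtr0_real// => eps e0.
  move/cvgrPdist_lt: qx => /(_ _ e0)[N _ hN].
  rewrite (le_trans (ler_distD (q (n + N)%N).1 _ _))// addrC lerD//.
  by apply/ltW/hN => /=; rewrite leq_addl.
have [B hB] := Tb x; have [n Bn] := archK B.
have [_ _ _ [i /(_ x (xq n.+1))]] := gP (n, q n) (q0 n).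
move=> /= /(lt_trans Bn)/lt_le_trans/(_ (hB i)).
by rewrite (ger0_norm (le_trans (normr_ge0 _) (hB i))) ltxx.
Qed.
End uniform_boundedness.

(** * Rearrangements and bounded multipliers *)

(** Given a finite set F M beyond each M, there is a rearrangement of the natural
    numbers that runs through F M consecutively for arbitrarily large M. It is
    built in blocks: after the numbers below M are exhausted, list F M first, then
    the numbers that it skipped. *)
Lemma block_bijection (F : nat -> seq nat) :
  (forall M, uniq (F M) /\ all (leq M) (F M)) ->
  exists2 p : nat -> nat, bijective p & forall N, exists M, (N <= M)%N /\
    map p (iota M (size (F M))) = F M.
Proof.
move=> FP.
(* The block that starts at M covers the numbers from M up to top M. *)
pose top M := maxn M.+1 (\max_(i <- F M) i.+1).
pose next L := L ++ F (size L) ++ [seq i <- iota (size L) (top (size L) - size L) | i \notin F (size L)].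
pose L n := iter n next [::].
have blockP M : perm_eq (F M ++ [seq i <- iota M (top M - M) | i \notin F M]) (iota M (top M - M)).
  have [uF MF] := FP M; have Mtop : (M <= top M)%N by rewrite /top leq_max ltnW.
  apply: uniq_perm; last 1 first.
  - move=> i; rewrite mem_cat mem_filter; case: (boolP (i \in F M)) => //= iF.
    rewrite mem_iota subnKC// (allP MF)//=; apply/esym.
    by rewrite /top leq_max; apply/orP; right; rewrite (big_rem i)//= leq_maxl.
  - rewrite cat_uniq uF filter_uniq ?iota_uniq// andbT; apply/hasPn => i.
    by rewrite mem_filter => /andP[].
  - exact: iota_uniq.
have LS n : L n.+1 = next (L n) by [].
have LP n : perm_eq (L n) (iota 0 (size (L n))).
  elim: n => // n ih; rewrite LS /next; set M := size (L n); rewrite !size_cat -!size_cat.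
  have Mtop : (M <= top M)%N by rewrite /top leq_max ltnW.
  rewrite size_cat (perm_size (blockP M)) size_iota -/M iotaD add0n.
  by rewrite perm_cat.
have sizeS n : size (L n.+1) = top (size (L n)).
  have Mtop : (size (L n) <= top (size (L n)))%N by rewrite /top leq_max ltnW.
  by rewrite LS /next size_cat (perm_size (blockP _)) size_iota subnKC.
have size_ge n : (n <= size (L n))%N.
  elim: n => // n ih; rewrite sizeS (leq_ltn_trans ih)//.
  by rewrite /top leq_max ltnSn.
have prefL n k : exists s, L (n + k)%N = L n ++ s.
  elim: k => [|k [s ih]]; first by exists [::]; rewrite addn0 cats0.
  by rewrite addnS LS /next ih; eexists; rewrite -catA; reflexivity.
have uL n : uniq (L n) by rewrite (perm_uniq (LP n)) iota_uniq.
have memL n i : (i \in L n) = (i < size (L n))%N by rewrite (perm_mem (LP n)) mem_iota add0n.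
have nth_stable n m i : (i < size (L n))%N -> (i < size (L m))%N -> nth 0%N (L n) i = nth 0%N (L m) i.
  wlog nm : n m / (n <= m)%N.
    by case: (leqP n m) => [|/ltnW] h w h1 h2; [exact: w|apply/esym/w].
  by move=> h1 _; have [s] := prefL n (m - n)%N; rewrite subnKC// => ->; rewrite nth_cat h1.
have index_stable n m i : i \in L n -> i \in L m -> index i (L n) = index i (L m).
  wlog nm : n m / (n <= m)%N.
    by case: (leqP n m) => [|/ltnW] h w h1 h2; [exact: w|apply/esym/w].
  by move=> h1 _; have [s] := prefL n (m - n)%N; rewrite subnKC// => ->; rewrite index_cat h1.
(* L n is a growing list of length at least n, so i is in reach of L i.+1. *)
pose p i := nth 0%N (L i.+1) i; pose q i := index i (L i.+1).
have pE n i : (i < size (L n))%N -> p i = nth 0%N (L n) i.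
  by move=> h; apply: nth_stable => //; exact: size_ge.
have qE n i : i \in L n -> q i = index i (L n).
  by move=> h; apply: index_stable => //; rewrite memL; exact: size_ge.
exists p.
  exists q => i.
    have h := size_ge i.+1; rewrite (qE i.+1) ?mem_nth//.
    by rewrite /p index_uniq.
  have h : i \in L i.+1 by rewrite memL; exact: size_ge.
  by rewrite (pE i.+1) ?index_mem// nth_index.
move=> N; exists (size (L N)); split => //; set M := size (L N).
have sF : (M + size (F M) <= size (L N.+1))%N by rewrite LS /next !size_cat addnA leq_addr.
apply: (@eq_from_nth _ 0%N); first by rewrite size_map size_iota.
move=> i; rewrite size_map size_iota => iF; rewrite (nth_map 0%N) ?size_iota//.
rewrite nth_iota// (pE N.+1); last by rewrite (leq_trans _ sF)// ltn_add2l.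
by rewrite LS /next -/M nth_cat ltnNge leq_addr /= addKn nth_cat iF.
Qed.

Section multipliers.
Context {K : numClosedFieldType} {V : normedModType K}.
Implicit Types (v : nat -> V) (r : seq nat) (B : K).

(** The norm is convex in each t_i, so its maximum is attained where every t_i is
    0 or 1. *)
Lemma unit_interval_multiplier v r B w (t : nat -> K) : uniq r ->
  (forall P : pred nat, `|w + \sum_(i <- r | P i) v i| <= B) ->
  (forall i, 0 <= t i <= 1) -> `|w + \sum_(i <- r) t i *: v i| <= B.
Proof.
elim: r w => [|i r ih] w.
  by move=> _ /(_ xpredT); rewrite !big_nil.
move=> /= /andP[ir ur] wB t01; rewrite big_cons.
set S := \sum_(j <- r) t j *: v j.
have /andP[t0 t1] := t01 i.
have -> : w + (t i *: v i + S) = t i *: (w + v i + S) + (1 - t i) *: (w + S).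
  rewrite (_ : w + v i + S = v i + (w + S)); last by rewrite addrA [v i + w]addrC.
  by rewrite scalerDr scalerBl scale1r addrACA subrr addr0 addrCA.
rewrite (le_trans (ler_normD _ _))// !normrZ !ger0_norm ?subr_ge0//.
have eqP' b (P : pred nat) :
    \sum_(j <- r | (if j == i then b else P j)) v j = \sum_(j <- r | P j) v j.
  rewrite big_seq_cond [RHS]big_seq_cond; apply: eq_bigl => j.
  by case: eqP => // ->; rewrite (negPf ir).
have h1 : `|w + v i + S| <= B.
  apply: ih => // P; have := wB (fun j => if j == i then true else P j).
  by rewrite big_cons eqxx eqP' addrA.
have h2 : `|w + S| <= B.
  apply: ih => // P; have := wB (fun j => if j == i then false else P j).
  by rewrite big_cons eqxx eqP'.
have -> : B = t i * B + (1 - t i) * B by rewrite -mulrDl subrKC mul1r.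
by rewrite lerD// ler_wpM2l// subr_ge0.
Qed.

Lemma unit_disc_multiplier v r B (t : nat -> K) : uniq r ->
  (forall P : pred nat, `|\sum_(i <- r | P i) v i| <= B) ->
  (forall i, `|t i| <= 1) -> `|\sum_(i <- r) t i *: v i| <= 4 * B.
Proof.
move=> ur vB t1.
have part (c : nat -> K) : (forall i, c i \is Num.real /\ `|c i| <= 1) ->
    `|\sum_(i <- r) c i *: v i| <= 2 * B.
  move=> c1.
  pose a i := (`|c i| + c i) / 2; pose b i := (`|c i| - c i) / 2.
  have cab i : c i = a i - b i by rewrite /a /b; field.
  have a01 i : 0 <= a i <= 1.
    have [cr ci] := c1 i; have nc : - c i <= `|c i| by rewrite -normrN real_ler_norm// realN.
    rewrite /a divr_ge0//=; last by rewrite -lerBlDr sub0r.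
    by rewrite ler_pdivrMr// mul1r -[2]/(1 + 1) lerD// (le_trans (real_ler_norm cr)).
  have b01 i : 0 <= b i <= 1.
    have [cr ci] := c1 i; rewrite /b divr_ge0 ?subr_ge0 ?real_ler_norm//=.
    rewrite ler_pdivrMr// mul1r -[2]/(1 + 1) lerD// (le_trans _ ci)//.
    by rewrite -normrN real_ler_norm// realN.
  under eq_bigr do rewrite cab scalerBl.
  rewrite sumrB (le_trans (ler_normB _ _))// mulrDl mul1r lerD//.
    rewrite -[X in `|X|]add0r; apply: unit_interval_multiplier => // P; rewrite add0r; exact: vB.
  rewrite -[X in `|X|]add0r; apply: unit_interval_multiplier => // P; rewrite add0r; exact: vB.
have -> : \sum_(i <- r) t i *: v i =
    \sum_(i <- r) 'Re (t i) *: v i + 'i *: \sum_(i <- r) 'Im (t i) *: v i.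
  rewrite scaler_sumr -big_split; apply: eq_bigr => i _ /=.
  by rewrite scalerA -scalerDl -Crect.
rewrite (le_trans (ler_normD _ _))// normrZ normCi mul1r.
rewrite (_ : 4 * B = 2 * B + 2 * B); last by rewrite -mulrDl -natrD.
rewrite lerD// part// => i; split; rewrite ?Creal_Re ?Creal_Im// (le_trans _ (t1 i))//.
  by rewrite (leif_normC_Re_Creal (t i)).
rewrite -(@ler_pXn2r _ 2) ?nnegrE// [leRHS]normC2_Re_Im real_normK ?Creal_Im//.
by rewrite lerDr -real_normK ?Creal_Re// exprn_ge0.
Qed.
End multipliers.

(** * Multipliers on an unconditional basis *)

Lemma cvg_sum_seq (K : numFieldType) (V : normedModType K) (T I : Type) (F : set_system T)
    (FF : Filter F) (r : seq I) (u : I -> T -> V) (a : I -> V) :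
  (forall i, u i x @[x --> F] --> a i) ->
  \sum_(i <- r) u i x @[x --> F] --> \sum_(i <- r) a i.
Proof.
move=> ua; elim: r => [|i r ih].
  by under eq_fun do rewrite big_nil; rewrite big_nil; exact: cvg_cst.
by under eq_fun do rewrite big_cons; rewrite big_cons; exact: cvgD.
Qed.

Section unconditional_basis.
Context {K : numClosedFieldType} {X : completeNormedModType K} (e : nat -> X).
Context (archK : archimedean_field K) (ballK : compact_balls K).
Context (e_basis : schauder_basis e) (e_unc : unconditional e).
Implicit Types (t : nat -> K) (x y : X) (A : set X).

(** Otherwise there are finite sets beyond every M whose partial sums are not
    small. A rearrangement that runs through infinitely many of them consecutively
    has partial sums that are not Cauchy. *)
Lemma finite_tail x (eps : K) : 0 < eps -> exists M, forall r : seq nat, uniq r -> all (leq M) r ->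
  `|\sum_(i <- r) coef e i x *: e i| <= eps.
Proof.
move=> e0; apply: contrapT => h.
have /choice[F FP] : forall M, exists r : seq nat, [/\ uniq r, all (leq M) r &
    ~ `|\sum_(i <- r) coef e i x *: e i| <= eps].
  move=> M; apply: contrapT => h'; apply: h; exists M => r ur Mr.
  by apply: contrapT => nr; apply: h'; exists r.
have [p bp pP] : exists2 p : nat -> nat, bijective p & forall N, exists M, (N <= M)%N /\
    map p (iota M (size (F M))) = F M.
  by apply: block_bijection => M; have [] := FP M.
have [y] := e_unc x bp.
set u := fun k => _ => /cvgrPdist_le/(_ (eps / 2) (divr_gt0 e0 (ltr0n K 2)))[N _ hN].
have [M [NM pM]] := pP N; have [_ _] := FP M; apply.
have -> : \sum_(i <- F M) coef e i x *: e i = series u (M + size (F M))%N - series u M.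
  rewrite -pM big_map size_map size_iota /series /= (big_cat_nat (n := M) (p := (M + size (F M))%N))//= ?leq_addr//.
  by rewrite addrAC subrr add0r /index_iota addKn.
rewrite (le_trans (ler_distD y _ _))// [leRHS]splitr lerD//.
  by rewrite distrC; apply: hN => /=; rewrite (leq_trans NM)// leq_addr.
by apply: hN.
Qed.

Lemma multiplier_tail x (c eps : K) : 0 < c -> 0 < eps -> exists M, forall t m M',
  (forall i, `|t i| <= c) -> (M <= M')%N ->
  `|\sum_(M' <= i < m) (t i * coef e i x) *: e i| <= eps.
Proof.
move=> c0 e0; have e40 : 0 < eps / (4 * c) by rewrite divr_gt0// mulr_gt0.
have [M hM] := finite_tail x e40; exists M => t m M' t1 MM'.
rewrite (_ : \sum_(M' <= i < m) _ = c *: \sum_(M' <= i < m) (t i / c) *: (coef e i x *: e i)); last first.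
  by rewrite scaler_sumr; apply: eq_bigr => i _; rewrite !scalerA; congr (_ *: _); field; rewrite gt_eqF.
rewrite normrZ gtr0_norm// (_ : eps = c * (4 * (eps / (4 * c)))); last by field; rewrite gt_eqF.
rewrite ler_pM2l//; apply: unit_disc_multiplier; first exact: iota_uniq.
  move=> P; rewrite -big_filter; apply: hM; first by rewrite filter_uniq// iota_uniq.
  by apply/allP => i; rewrite mem_filter mem_index_iota => /and3P[_ M'i _]; exact: leq_trans M'i.
by move=> i; rewrite normrM normfV (gtr0_norm c0) ler_pdivrMr// mul1r.
Qed.

(** The unconditional constant, from uniform boundedness applied to all finite
    multiplier sums at once. *)
Lemma multiplier_bound (c : K) : 0 < c -> exists2 C : K, 0 < C & forall t M m x,
  (forall i, `|t i| <= c) -> `|\sum_(M <= i < m) (t i * coef e i x) *: e i| <= C * `|x|.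
Proof.
move=> c0.
pose I := {p : (nat -> K) * nat | forall i, `|p.1 i| <= c}.
pose T (i : I) x := \sum_(0 <= j < (sval i).2) ((sval i).1 j * coef e j x) *: e j.
have [|||C C0 hC] := @uniform_boundedness K archK X X I T.
- move=> [[t m] tc] a x y; rewrite /T /= scaler_sumr -big_split; apply: eq_bigr => j _ /=.
  by rewrite coef_linear// mulrDr scalerDl scalerA [t j * (a *: _)]mulrCA.
- move=> [[t m] tc] x; rewrite /T /=.
  apply: cvg_sum_seq => j; apply: cvgZr_tmp; apply: cvgM; first exact: cvg_cst.
  exact: e_basis.2.
- move=> x; have [M hM] := multiplier_tail x c0 ltr01.
  exists (\sum_(0 <= j < M) c * `|coef e j x| * `|e j| + 1) => -[[t m] tc]; rewrite /T /=.
  have term j : `|(t j * coef e j x) *: e j| <= c * `|coef e j x| * `|e j|.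
    by rewrite normrZ normrM ler_wpM2r// ler_wpM2r// tc.
  have term0 j : 0 <= c * `|coef e j x| * `|e j| by rewrite !mulr_ge0// ltW.
  have [mM|Mm] := leqP m M.
    rewrite (big_cat_nat (n := m) (p := M))//= -addrA ler_wpDr//.
      by rewrite addr_ge0// sumr_ge0.
    by rewrite (le_trans (ler_norm_sum _ _ _))// ler_sum.
  rewrite (big_cat_nat (n := M))//= ?(ltnW Mm)// (le_trans (ler_normD _ _))// lerD ?hM//.
  by rewrite (le_trans (ler_norm_sum _ _ _))// ler_sum.
exists C => // t M m x tc.
pose t' i := if (M <= i)%N then t i else 0.
have t'c i : `|t' i| <= c by rewrite /t'; case: ifP => // _; rewrite normr0 ltW.
rewrite [X in `|X|](_ : _ = \sum_(0 <= i < m) (t' i * coef e i x) *: e i).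
  exact: (hC (exist _ (t', m) t'c)).
have [mM|Mm] := leqP m M.
  rewrite big_geq// big_nat big1// => i /andP[_ im].
  by rewrite /t' leqNgt (leq_trans im mM) mul0r scale0r.
rewrite [RHS](big_cat_nat (n := M))//= ?(ltnW Mm)//.
rewrite [X in _ = X + _]big_nat [X in _ = X + _]big1 ?add0r; last first.
  by move=> i /andP[_ iM]; rewrite /t' leqNgt iM mul0r scale0r.
by rewrite big_nat [RHS]big_nat; apply: eq_bigr => i /andP[Mi _]; rewrite /t' Mi.
Qed.

Lemma coefD n x y : coef e n (x + y) = coef e n x + coef e n y.
Proof. by have := coef_linear n e_basis 1 x y; rewrite !scale1r. Qed.

Lemma compact_tail A (c eps : K) : compact A -> 0 < c -> 0 < eps -> exists M, forall x, A x ->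
  forall t m M', (forall i, `|t i| <= c) -> (M <= M')%N ->
  `|\sum_(M' <= i < m) (t i * coef e i x) *: e i| <= eps.
Proof.
move=> cA c0 e0.
have [C C0 hC] := multiplier_bound c0.
have e2 : 0 < eps / 2 by rewrite divr_gt0.
have [|M hM] := @compact_eventually X A (fun M x => forall t m, (forall i, `|t i| <= c) ->
    `|\sum_(M <= i < m) (t i * coef e i x) *: e i| <= eps) cA.
  move=> x0 _; have [M hM] := multiplier_tail x0 c0 e2; exists M.
  have d0 : 0 < eps / 2 / C by rewrite divr_gt0.
  near=> x => n Mn t m tc.
  rewrite (_ : \sum_(n <= i < m) _ = \sum_(n <= i < m) (t i * coef e i x0) *: e i
      + \sum_(n <= i < m) (t i * coef e i (x - x0)) *: e i); last first.
    rewrite -big_split; apply: eq_bigr => i _ /=.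
    by rewrite -scalerDl -mulrDr -coefD addrC subrK.
  rewrite [eps]splitr (le_trans (ler_normD _ _))// lerD ?hM// (le_trans (hC _ _ _ _ tc))//.
  rewrite mulrC -ler_pdivlMr// distrC ltW//; near: x.
by exists M => x Ax t m M' tc MM'; exact: hM.
Unshelve. all: by end_near. Qed.

Definition multiplier t m x : X := combination e m (fun i => t i * coef e i x).

Lemma multiplierB t x M m : (M <= m)%N ->
  multiplier t m x = multiplier t M x + \sum_(M <= i < m) (t i * coef e i x) *: e i.
Proof.
move=> Mm; rewrite /multiplier /combination -!(big_mkord xpredT (fun i => (t i * coef e i x) *: e i)).
by rewrite (big_cat_nat (n := M)).
Qed.

Lemma multiplier1_cvg x : multiplier (fun=> 1) m x @[m --> \oo] --> x.
Proof.
have := coef_expansion (x := x) e_basis; rewrite /expansion (_ : series _ = multiplier (fun=> 1) ^~ x)//.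
apply/funext => m; rewrite /series /= big_mkord; apply: eq_bigr => i _.
by rewrite mul1r.
Qed.

Lemma cvg_multiplier (T : Type) (F : set_system T) (FF : Filter F) m
    (t : T -> nat -> K) (y : T -> X) (t0 : nat -> K) (y0 : X) :
  (forall i, (t p i : K^o) @[p --> F] --> (t0 i : K^o)) -> y @ F --> y0 ->
  multiplier (t p) m (y p) @[p --> F] --> multiplier t0 m y0.
Proof.
move=> tt0 yy0; rewrite /multiplier /combination.
apply: (@cvg_sum_seq K X T 'I_m F FF _ (fun i p => (t p i * coef e i (y p)) *: e i)
  (fun i => (t0 i * coef e i y0) *: e i)) => i.
apply: cvgZr_tmp; apply: (@cvgM _ _ F FF (fun p => t p i) (fun p => coef e i (y p))).
  exact: tt0.
by apply: (@cvg_comp _ _ _ y (coef e i)); [exact: yy0|exact: e_basis.2].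
Qed.

(** Near a point q of [D] the finite sums depend continuously on the point, while
    the tails are small uniformly on [A]; so for p near q all late sums lie close
    to the limit at q, where [f] is continuous. *)
Lemma multiplier_cvg_family (T : topologicalType) (D : set T) (t : T -> nat -> K) (y : T -> X)
    (f : X -> K) A (c eps : K) : continuous (f : X -> K^o) ->
  compact D -> compact A -> (forall p, D p -> A (y p) /\ forall i, `|t p i| <= c) ->
  (forall m p0, multiplier (t p) m (y p) @[p --> p0] --> multiplier (t p0) m (y p0)) ->
  0 < c -> 0 < eps -> exists M, forall m, (M <= m)%N -> forall p, D p ->
  `|f (multiplier (t p) m (y p)) - f (multiplier (t p) M (y p))| <= eps.
Proof.
move=> cf cD cA DP cty c0 e0; have e2 : 0 < eps / 2 by rewrite divr_gt0.
pose P M (p : T) : Prop := D p -> forall m, (M <= m)%N ->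
  `|f (multiplier (t p) m (y p)) - f (multiplier (t p) M (y p))| <= eps.
have [|M hM] := @compact_eventually T D P cD; last first.
  by exists M => m Mm p Dp; exact: (hM M (leqnn M) p Dp Dp).
move=> q /[dup] Dq /DP[Ayq tqc].
have [p0 hp0] : exists p0 : X, multiplier (t q) m (y q) @[m --> \oo] --> p0.
  apply: cauchy_tail_cvg => d d0; have [M hM] := compact_tail cA c0 d0; exists M => n Mn.
  by rewrite (multiplierB _ _ Mn) addrAC subrr add0r hM.
have /cvgrPdist_lt/(_ _ e2)/nbhs_ballP[d /= d0 hd] := cf p0.
have d4 : 0 < d / 4 by rewrite divr_gt0.
have [M hM] := compact_tail cA c0 d4; exists M.
have dist0 : `|p0 - multiplier (t q) M (y q)| <= d / 4.
  apply: ler_eps; rewrite ?normr_real ?gtr0_real// => a a0.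
  move/cvgrPdist_lt: hp0 => /(_ _ a0)[N _ hN].
  rewrite (le_trans (ler_distD (multiplier (t q) (M + N) (y q)) _ _))// addrC lerD//.
    by rewrite (multiplierB _ _ (leq_addr N M)) addrAC subrr add0r hM.
  by apply/ltW/hN => /=; rewrite leq_addl.
have /cvgrPdist_lt/(_ _ d4) := cty M q; apply: filterS => p h1 n Mn Dp m nm.
have [Ayp tpc] := DP p Dp.
have close k : (M <= k)%N -> `|f p0 - f (multiplier (t p) k (y p))| < eps / 2.
  move=> Mk; apply: hd; rewrite -ball_normE /=.
  rewrite (le_lt_trans (ler_distD (multiplier (t q) M (y q)) _ _))//.
  have h2 : `|multiplier (t p) M (y p) - multiplier (t p) k (y p)| <= d / 4.
    by rewrite distrC (multiplierB _ _ Mk) addrAC subrr add0r hM.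
  rewrite (@le_lt_trans _ _ (d / 4 + (d / 4 + d / 4)))//.
    by rewrite lerD// (le_trans (ler_distD (multiplier (t p) M (y p)) _ _))// lerD// ltW.
  by rewrite -subr_gt0 (_ : _ - _ = d / 4)//; field.
rewrite [eps]splitr (le_trans (ler_distD (f p0) _ _))// lerD//.
  by rewrite distrC ltW// close// (leq_trans Mn).
by rewrite ltW// close.
Qed.

Let sequences := prod_topology (fun _ : nat => K^o).

Lemma multiplier_continuous m (p0 : X * sequences) :
  multiplier p.2 m p.1 @[p --> p0] --> multiplier p0.2 m p0.1.
Proof.
have h1 : @fst X sequences @ nbhs p0 --> p0.1 by exact: cvg_fst.
have h2 i : ((p.2 i : K^o) @[p --> p0] --> (p0.2 i : K^o)).
  have hs : @snd X sequences @ nbhs p0 --> p0.2 by exact: cvg_snd.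
  have hp : @proj nat (fun=> K^o) i @ nbhs p0.2 --> (p0.2 i : K^o).
    exact: (@proj_continuous nat (fun=> K^o) i p0.2).
  exact: cvg_comp hs hp.
exact: (@cvg_multiplier (X * sequences)%type (nbhs p0) _ m (fun p => p.2) fst p0.2 p0.1 h2 h1).
Qed.

(** Tychonoff's theorem for the sequences of multipliers. *)
Lemma multiplier_domain_compact A (c : K) : compact A ->
  compact [set p : X * sequences | A p.1 /\ forall i, `|p.2 i| <= c].
Proof.
move=> cA; apply: (@compact_setX X sequences A [set t | forall i, `|t i| <= c]) => //.
exact: (@tychonoff _ (fun _ : nat => K^o) (fun=> [set z : K^o | `|z| <= c]) (fun=> @ballK c)).
Qed.

Lemma multiplier_cvg_uniform (f : X -> K) A (c eps : K) : continuous (f : X -> K^o) ->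
  compact A -> 0 < c -> 0 < eps -> exists M, forall m, (M <= m)%N -> forall x, A x ->
  forall t, (forall i, `|t i| <= c) -> `|f (multiplier t m x) - f (multiplier t M x)| <= eps.
Proof.
move=> cf cA c0 e0.
have [|M hM] := @multiplier_cvg_family (X * sequences)%type _ (fun p => p.2) fst f A c eps cf
    (@multiplier_domain_compact A c cA) cA (fun p Dp => Dp) _ c0 e0.
  by move=> m p0; exact: multiplier_continuous.
by exists M => m Mm x Ax t tc; exact: (hM m Mm (x, t) (conj Ax tc)).
Qed.

Lemma multiplier_bounded (f : X -> K) A (c : K) : continuous (f : X -> K^o) ->
  compact A -> 0 < c -> exists2 G : K, 0 <= G & forall m x t, A x -> (forall i, `|t i| <= c) ->
  `|f (multiplier t m x)| <= G.
Proof.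
move=> cf cA c0; have [M hM] := multiplier_cvg_uniform cf cA c0 ltr01.
have [|B hB] := @compact_norm_bounded K _ _ (fun p : X * sequences => f (multiplier p.2 M p.1))
    archK (@multiplier_domain_compact A c cA).
  move=> p; apply: (@cvg_comp _ _ _ (fun p : X * sequences => multiplier p.2 M p.1) (f : X -> K^o)).
    exact: multiplier_continuous.
  exact: cf.
have B0 x t : A x -> (forall i, `|t i| <= c) -> `|f (multiplier t M x)| <= B.
  by move=> Ax tc; exact: (hB (x, t)).
exists (`|B| + 1); first by rewrite addr_ge0.
have large m x t : A x -> (forall i, `|t i| <= c) -> (M <= m)%N -> `|f (multiplier t m x)| <= `|B| + 1.
  move=> Ax tc Mm; rewrite -[f _](subrK (f (multiplier t M x))) addrC.
  rewrite (le_trans (ler_normD _ _))// lerD ?hM//.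
  have h := B0 x t Ax tc; apply: (le_trans h); rewrite ger0_norm//.
  exact: le_trans (normr_ge0 _) h.
move=> m x t Ax tc; have [mM|Mm] := leqP M m; first exact: large.
pose t' i := if (i < m)%N then t i else 0.
have -> : multiplier t m x = multiplier t' M x.
  rewrite /multiplier (@combination_widen K X e m M) ?(ltnW Mm)//.
    by apply: eq_bigr => i _; rewrite /t' ltn_ord.
  by move=> i mi; rewrite /t' ltnNge mi mul0r.
apply: large => // i; rewrite /t'; case: ifP => // _; rewrite normr0 ltW//.
Unshelve. all: by end_near. Qed.

End unconditional_basis.

(** * The square order as a colexicographic order *)

Fixpoint colex_le m (b a : nat -> nat) : bool :=
  if m is m'.+1 then (b m' < a m')%N || ((b m' == a m') && colex_le m' b a) else true.

Lemma colex_lexx m a : colex_le m a a.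
Proof. by elim: m => //= m ->; rewrite eqxx orbT. Qed.

Lemma colex_lt m j (b a : nat -> nat) : (j < m)%N -> (b j < a j)%N ->
  (forall i, (j < i)%N -> b i = a i) -> colex_le m b a /\ ~~ colex_le m a b.
Proof.
move=> jm ba eqba; elim: m jm => // m ih; rewrite ltnS leq_eqVlt => /predU1P[<-|jm] /=.
  by rewrite ba; split => //; rewrite negb_or -leqNgt (ltnW ba) gtn_eqF.
have [h1 h2] := ih jm; rewrite eqba// eqxx ltnn/=.
by split; [exact: h1|exact: h2].
Qed.

(** When the lengths differ, the deciding index is the last one in the support of
    the longer multi-index: the other multi-index vanishes from there on. *)
Lemma square_lt_colex m (al be : multiindex) : (mlen al <= m)%N -> (mlen be <= m)%N ->
  square_lt al be -> colex_le m al be /\ ~~ colex_le m be al.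
Proof.
move=> am bm; case=> [ab|[ab [j [neq top] lt]]].
  case E : (mlen be) ab => [//|k]; rewrite ltnS => ak.
  have bk : (0 < be k)%N.
    rewrite lt0n; apply/eqP => bk; have : (mlen be <= k)%N.
      apply: mlen_leP => i; rewrite leq_eqVlt => /predU1P[<-//|ki].
      by rewrite mlen_eq0// E.
    by rewrite E ltnn.
  apply: (@colex_lt _ k); [by rewrite -E|by rewrite (mlen_eq0 ak)|].
  by move=> i ki; rewrite !mlen_eq0 ?E// (leq_trans ak)// ltnW.
apply: (@colex_lt _ j) => //.
  rewrite ltnNge; apply/negP => mj; move: lt; rewrite (@mlen_eq0 be)//.
  exact: leq_trans mj.
by move=> i ji; apply: contrapT => /top; rewrite leqNgt ji.
Qed.

Section partial_sums.
Context {K : numClosedFieldType}.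

(** The key estimate. Splitting off the last variable leaves the terms with a
    smaller last exponent, which are a m groups each bounded by [M], and the terms
    with last exponent a m, to which the induction hypothesis applies. *)
Lemma colex_partial_sum_le (I : Type) m (r : seq I) (b : I -> nat -> nat) (a : nat -> nat)
    (c : I -> K) (M : K) :
  (forall t : nat -> K, (forall i, `|t i| <= 1) ->
     `|\sum_(j <- r) c j * \prod_(i < m) t i ^+ b j i| <= M) ->
  `|\sum_(j <- r | colex_le m (b j) a) c j| <= (\sum_(i < m) a i).+1%:R * M.
Proof.
elim: m r => [|m ih] r cM.
  have := cM (fun=> 0); under eq_bigr do rewrite big_ord0 mulr1.
  by rewrite big_ord0 mul1r; apply => i; rewrite normr0.
have extract k (t : nat -> K) : (forall i, `|t i| <= 1) ->
    `|\sum_(j <- r | b j m == k) c j * \prod_(i < m) t i ^+ b j i| <= M.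
  (* With 2^L above all exponents of the last variable, averaging isolates the
     exponent k exactly. *)
  move=> t1; pose L := (k + \sum_(j <- r) b j m)%N.
  rewrite (_ : \sum_(j <- r | _) _ = avg L (fun u =>
     (\sum_(j <- r) c j * \prod_(i < m.+1) update t m u i ^+ b j i) / u ^+ k)); last first.
    transitivity (avg L (fun u => \sum_(j <- r)
        (c j * \prod_(i < m) t i ^+ b j i) * (u ^+ b j m / u ^+ k))); last first.
      congr avg; apply/funext => u; rewrite mulr_suml; apply: eq_bigr => j _.
      rewrite big_ord_recr /= update_eq; set P := \prod_(i < m) _; set P' := \prod_(i < m) _.
      have -> : P' = P by apply: eq_bigr => i _; rewrite /update ltn_eqF.
      by ring.
    have L2 := ltn_expl L (ltnSn 1).
    have kL : (k < 2 ^ L)%N by rewrite (leq_ltn_trans _ L2)// leq_addr.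
    rewrite avg_sum big_mkcond.
    have : (\sum_(j <- r) b j m <= L)%N by rewrite leq_addl.
    elim: (r) => [|j r' ihr] rL; first by rewrite !big_nil.
    rewrite !big_cons in rL *; rewrite ihr ?(leq_trans _ rL) ?leq_addl//; congr (_ + _).
    rewrite avgZ avg_mono !modn_small//; last first.
      by rewrite (leq_ltn_trans _ L2)// (leq_trans _ rL)// leq_addr.
    by case: eqP => _; rewrite ?mulr1 ?mulr0.
  apply: norm_avg_le => u u1; rewrite normrM normfV normrX u1 expr1n divr1.
  by apply: cM => i; rewrite /update; case: ifP => // _; rewrite u1.
rewrite /= (bigID (fun j => (b j m < a m)%N)) /=.
rewrite (eq_bigl (fun j => (b j m < a m)%N)); last first.
  by move=> j; case: ltnP; rewrite ?andbT ?andbF.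
rewrite [X in _ + X](eq_bigl (fun j => (b j m == a m) && colex_le m (b j) a)); last first.
  by move=> j; case: ltngtP; rewrite ?andbF ?andbT.
rewrite big_ord_recr /= -addSn natrD mulrDl addrC (le_trans (ler_normD _ _))// lerD//.
  rewrite -big_filter_cond; apply: ih => t t1; rewrite big_filter; exact: extract.
rewrite (_ : \sum_(j <- r | _) _ = \sum_(k < a m) \sum_(j <- r | b j m == k) c j).
  rewrite (le_trans (ler_norm_sum _ _ _))// mulr_natl -[X in _ *+ X]card_ord -sumr_const.
  apply: ler_sum => k _; have := extract k (fun=> 1).
  rewrite (eq_bigr c); first by apply=> i; rewrite normr1.
  by move=> j _; rewrite big1 ?mulr1// => i _; rewrite expr1n.
under [RHS]eq_bigr do rewrite big_mkcond.
rewrite exchange_big big_mkcond; apply: eq_bigr => j _ /=.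
have [bam|amb] := ltnP (b j m) (a m).
  rewrite (bigD1 (Ordinal bam))//= eqxx big1 ?addr0// => k.
  by rewrite -val_eqE /= eq_sym => /negPf ->.
rewrite big1// => k _; case: eqP => // bk; move: (ltn_ord k); rewrite -bk.
by rewrite ltnNge amb.
Qed.
End partial_sums.

(** * Partial sums of the monomial expansion *)

Section compatible.
Context (s : nat -> multiindex) (s_compat : compatible_ordering s).

Lemma compatible_inj : injective s.
Proof. exact: bij_inj s_compat.1. Qed.

Lemma compatible_surj be : exists n, s n = be.
Proof. by have [g _ gK] := s_compat.1; exists (g be). Qed.

(** Multi-indices of degree d in m variables all precede the d-th power of the
    next variable if d > 0, so a compatible ordering lists them before it. *)
Lemma compatible_finite m d : exists N, forall n, (mlen (s n) <= m)%N -> mdegree (s n) = d -> (n < N)%N.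
Proof.
have [be bem beE] := multiindexP m.+1 (fun i => if i == m then d else 0%N).
have [N sN] := compatible_surj be; exists N.+1 => n nm nd; rewrite ltnS leqNgt; apply/negP => Nn.
have ltm i : (i < m)%N -> be i = 0%N by move=> im; rewrite beE ?ltn_eqF// ltnW.
have dbe : mdegree be = d.
  rewrite (mdegreeE bem) big_ord_recr /= beE// eqxx big1// => i _; exact: ltm.
have [d0|dpos] := posnP d.
  have sn0 i : s n i = 0%N.
    have [im|] := ltnP i m; last by move=> mi; apply: mlen_eq0; exact: leq_trans nm mi.
    move: nd; rewrite d0 (mdegreeE nm) => /eqP; rewrite sum_nat_eq0.
    by move=> /forallP/(_ (Ordinal im))/eqP.
  suff : s N = s n by move=> /compatible_inj NE; rewrite NE ltnn in Nn.
  rewrite sN; apply: (multiindex_eq bem (leqW nm)) => i im.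
  by rewrite sn0 beE// d0; case: ifP.
have : square_lt (s N) (s n) by apply/(s_compat.2 N n _).1; rewrite ?sN ?dbe.
rewrite sN => lt; have [_ /negP] := square_lt_colex bem (leqW nm) lt; apply.
by rewrite /= (mlen_eq0 nm) beE// eqxx dpos.
Qed.

Lemma compatible_colex m n k : (mlen (s n) <= m)%N -> (mlen (s k) <= m)%N ->
  mdegree (s n) = mdegree (s k) -> colex_le m (s n) (s k) = (n <= k)%N.
Proof.
move=> nm km nk; case: ltngtP => [nk'|kn|->]; last exact: colex_lexx.
  by have /(square_lt_colex nm km)[] := (s_compat.2 n k nk).1 nk'.
have /(square_lt_colex km nm)[_ /negPf] := (s_compat.2 k n (esym nk)).1 kn.
by [].
Qed.

Context {K : numClosedFieldType}.

(** The degree [d] terms among the first [N] ones form an initial segment of the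
    colexicographic order; it ends at the last index below [N] of that degree. *)
Lemma degree_partial_sum_le m d N N' (c : nat -> K) (Q : K) : (N <= N')%N ->
  (forall n, (n < N)%N -> (mlen (s n) <= m)%N) ->
  (forall t : nat -> K, (forall i, `|t i| <= 1) ->
    `|\sum_(0 <= n < N' | (mlen (s n) <= m)%N && (mdegree (s n) == d)) c n * \prod_(i < m) t i ^+ s n i| <= Q) ->
  `|\sum_(0 <= n < N | mdegree (s n) == d) c n| <= d.+1%:R * Q.
Proof.
move=> NN' lenN cQ.
have Q0 : 0 <= Q by apply: le_trans (cQ (fun=> 0) _) => // i; rewrite normr0.
have [/hasP[n0]|none] := boolP (has (fun n => mdegree (s n) == d) (iota 0 N)); last first.
  rewrite big_nat_cond big1 ?normr0 ?mulr_ge0// => n /andP[/andP[_ nN] nd].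
  by case/hasP: none; exists n => //; rewrite mem_iota.
rewrite mem_iota add0n => /= n0N n0d.
have ex : exists n, (n < N)%N && (mdegree (s n) == d) by exists n0; rewrite n0N.
have ub n : (n < N)%N && (mdegree (s n) == d) -> (n <= N)%N by move=> /andP[/ltnW].
case: (ex_maxnP ex ub) => k /andP[kN /eqP kd] kmax.
have -> : \sum_(0 <= n < N | mdegree (s n) == d) c n =
   \sum_(n <- [seq n <- index_iota 0 N' | (mlen (s n) <= m)%N && (mdegree (s n) == d)]
      | colex_le m (s n) (s k)) c n.
  rewrite big_filter_cond !big_mkord (big_ord_widen_cond _ (fun n => mdegree (s n) == d) c NN').
  apply: eq_bigl => n; case: eqP => [nd|]; last by rewrite andbF.
  rewrite andbT; case: (leqP (mlen (s n)) m) => [nm|mn] /=; last first.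
    by apply: contraTF mn => /lenN; rewrite leqNgt.
  rewrite compatible_colex ?kd ?nd//; last exact: lenN.
  apply/idP/idP => [nN|nk]; last exact: leq_ltn_trans kN.
  by apply: kmax; rewrite nN; apply/eqP.
have := @colex_partial_sum_le K nat m [seq n <- index_iota 0 N' | (mlen (s n) <= m)%N && (mdegree (s n) == d)]
  (fun n i => s n i) (s k) c Q.
rewrite -(mdegreeE (lenN k kN)) kd; apply=> t t1.
by rewrite big_filter; exact: cQ.
Qed.

End compatible.

Section monomial_expansion.
Context {K : numClosedFieldType} {X : completeNormedModType K} (e : nat -> X).
Context (archK : archimedean_field K) (ballK : compact_balls K).
Context (e_basis : schauder_basis e) (e_unc : unconditional e).
Context (s : nat -> multiindex) (s_compat : compatible_ordering s).

Lemma entire_line_entire (f : entire_space X) : line_entire (f : X -> K).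
Proof.
move=> x v c; apply: (@differentiable_comp _ _ _ _ (fun t : K^o => x + t *: v) (f : X -> K^o)).
  apply: differentiableD; first exact: differentiable_cst.
  exact: (@differentiableZl K _ X (fun t : K^o => t) v c).
by have /asboolP := valP f; apply.
Qed.

Lemma entire_polydisc_bounded (f : entire_space X) : polydisc_bounded (f : X -> K).
Proof.
move=> e' m R; have [|B hB] := @compact_norm_bounded K X _ (f : X -> K) archK (@polydisc_compact K X ballK e' m R).
  by move=> x; exact: entire_continuous.
by exists B => z zR; apply: hB; exists z.
Qed.

(** As a function of the multiplier [t], the homogeneous part is a polynomial with
    the terms of the monomial expansion at [x] as coefficients. *)
Lemma homogeneous_part_multiplier (f : entire_space X) m d N (t : nat -> K) (x : X) :
  (forall n, (mlen (s n) <= m)%N -> mdegree (s n) = d -> (n < N)%N) ->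
  homogeneous_part f d (multiplier e t m x) =
  \sum_(0 <= n < N | (mlen (s n) <= m)%N && (mdegree (s n) == d))
    (coefficient e f (s n) * monomial_fun e (s n) x) * \prod_(i < m) t i ^+ s n i.
Proof.
move=> hN; rewrite /multiplier.
pose r := [seq s n | n <- index_iota 0 N & (mlen (s n) <= m)%N && (mdegree (s n) == d)].
rewrite (@homogeneous_part_expansion K X archK ballK e f m d _ r (@entire_line_entire f) (@entire_polydisc_bounded f)).
- rewrite /r big_map big_filter; apply: eq_bigr => n /andP[nm _].
  rewrite (monomial_funE e x nm) -mulrA -big_split; congr (_ * _); apply: eq_bigr => i _ /=.
  by rewrite exprMn mulrC.
- by rewrite map_inj_uniq ?filter_uniq ?iota_uniq//; exact: compatible_inj.
- move=> be; split => [/mapP[n]|[bem bed]].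
    by rewrite mem_filter => /andP[/andP[nm /eqP nd] _] ->.
  have [n sn] := compatible_surj s_compat be; apply/mapP; exists n => //.
  rewrite mem_filter mem_index_iota sn bem bed eqxx /=.
  by apply: hN; rewrite sn.
Qed.

Lemma partial_sum_degrees (c : nat -> K) N D : (forall n, (n < N)%N -> (mdegree (s n) < D)%N) ->
  \sum_(0 <= n < N) c n = \sum_(0 <= d < D) \sum_(0 <= n < N | mdegree (s n) == d) c n.
Proof.
move=> ND; under [RHS]eq_bigr do rewrite big_mkcond.
rewrite exchange_big /= big_nat [RHS]big_nat; apply: eq_bigr => n /andP[_ nN].
rewrite (bigD1_seq (mdegree (s n))) ?iota_uniq//=; last by rewrite mem_index_iota ND.
by rewrite eqxx big1 ?addr0// => d; rewrite eq_sym => /negPf ->.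
Qed.

Lemma degree_pow_le (d : nat) (c : K) : 0 <= c -> d.+1%:R * (c / 4 ^+ d) <= c / 2 ^+ d.
Proof.
move=> c0; rewrite mulrCA ler_wpM2l// ler_pdivrMr ?exprn_gt0//.
have -> : 4 ^+ d = 2 ^+ d * 2 ^+ d :> K by rewrite -exprMn -natrM.
by rewrite mulrA mulVf ?expf_neq0 ?pnatr_eq0// mul1r -natrX ler_nat ltn_expl.
Qed.

(** Degrees from D on contribute a geometric tail. For each degree d < D, and N so
    large that all degree d monomials in the first M variables are among the first
    N terms, these terms sum to P_d(y) with y the M-th section of x. The remaining
    ones are a partial sum of the expansion of P_d(t.x) - P_d(t.y), which is
    uniformly small. *)
Lemma monomial_expansion_uniform (f : entire_space X) (A : set X) (eps : K) :
  compact A -> 0 < eps -> exists N0, forall N, (N0 <= N)%N -> forall x, A x ->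
  `|f x - \sum_(0 <= n < N) coefficient e f (s n) * monomial_fun e (s n) x| <= eps.
Proof.
move=> cA e0.
have f_cont : continuous (f : X -> K^o) by exact: entire_continuous.
have four : 0 < 4 :> K by [].
have [G G0 hG] := multiplier_bounded archK ballK e_basis e_unc f_cont cA four.
pose eta := eps / 8; have eta0 : 0 < eta by rewrite divr_gt0.
have [M hM] := multiplier_cvg_uniform archK ballK e_basis e_unc f_cont cA four eta0.
have [D hD] := half_pow_small archK (8 * G) e0.
have {}hD : 8 * G / 2 ^+ D < eps by have := hD D (leqnn D); rewrite ger0_norm ?mulr_ge0.
have scale (u : K) (t : nat -> K) : `|u| = 1 -> (forall i, `|t i| <= 1) ->
    forall i, `|4 * u * t i| <= 4.
  by move=> u1 t1 i; rewrite !normrM u1 mulr1 ger0_norm// ler_piMr.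
have scaleE (u : K) t m x : (4 * u) *: multiplier e t m x = multiplier e (fun i => 4 * u * t i) m x.
  by rewrite /multiplier combinationZ; apply: eq_bigr => i _; rewrite mulrA.
have P_le d m x t : A x -> (forall i, `|t i| <= 1) ->
    `|homogeneous_part f d (multiplier e t m x)| <= G / 4 ^+ d.
  move=> Ax t1; apply: (homogeneous_part_le ballK) => u u1.
  by rewrite scaleE; apply: hG => //; exact: scale.
have P_close d m x t : A x -> (forall i, `|t i| <= 1) -> (M <= m)%N ->
    `|homogeneous_part f d (multiplier e t m x) - homogeneous_part f d (multiplier e t M x)| <= eta / 4 ^+ d.
  move=> Ax t1 Mm; apply: (@homogeneous_part_sub K X ballK f d _ _ eta) => [|u u1].
    exact: entire_polydisc_bounded.
  by rewrite !scaleE; apply: hM => //; exact: scale.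
have one_le (i : nat) : `|1 : K| <= 1 by rewrite normr1.
have f_close x : A x -> `|f x - f (multiplier e (fun=> 1) M x)| <= eta.
  move=> Ax; apply: ler_eps; rewrite ?normr_real ?gtr0_real// => a a0.
  have : f (multiplier e (fun=> 1) m x) @[m --> \oo] --> (f x : K^o).
    have h1 : multiplier e (fun=> 1) m x @[m --> \oo] --> x.
      exact: (multiplier1_cvg e_basis).
    have h2 : (f : X -> K^o) @ nbhs x --> (f x : K^o) by exact: f_cont.
    exact: cvg_comp h1 h2.
  move=> /cvgrPdist_lt/(_ _ a0)[N _ hN].
  rewrite (le_trans (ler_distD (f (multiplier e (fun=> 1) (M + N) x)) _ _))// addrC lerD//.
    apply: hM => //; first exact: leq_addr.
    by move=> i; rewrite normr1 ler1n.
  by apply/ltW/hN => /=; rewrite leq_addl.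
have [N0 hN0] : exists N0, forall n, (mlen (s n) <= M)%N -> (mdegree (s n) < D)%N -> (n < N0)%N.
  have [|N0 /(_ N0 (leqnn _)) hN0] := @eventually_all_lt (fun d N => forall n,
      (mlen (s n) <= M)%N -> mdegree (s n) = d -> (n < N)%N) D.
    move=> d; have [N hN] := compatible_finite s_compat M d; exists N => L NL n nM nd.
    by rewrite (leq_trans (hN n nM nd)).
  by exists N0 => n nM nD; exact: (hN0 _ nD n).
exists N0 => N N0N x Ax.
pose a n := coefficient e f (s n) * monomial_fun e (s n) x.
pose y := multiplier e (fun=> 1) M x.
pose m := maxn M (\max_(n < N) mlen (s n)).
have Mm : (M <= m)%N by rewrite leq_maxl.
have lenm n : (n < N)%N -> (mlen (s n) <= m)%N.
  move=> nN; rewrite leq_max; apply/orP; right.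
  exact: (leq_bigmax (Ordinal nN)).
pose D' := maxn D (\max_(n < N) (mdegree (s n)).+1).
have DD' : (D <= D')%N by rewrite leq_maxl.
have degD' n : (n < N)%N -> (mdegree (s n) < D')%N.
  move=> nN; rewrite leq_max; apply/orP; right.
  exact: (@leq_bigmax _ (fun n : 'I_N => (mdegree (s n)).+1) (Ordinal nN)).
have finite d : exists N', (N <= N')%N /\
    (forall n, (mlen (s n) <= m)%N -> mdegree (s n) = d -> (n < N')%N).
  have [N' hN'] := compatible_finite s_compat m d; exists (maxn N N').
  split; first exact: leq_maxl.
  by move=> n nm nd; rewrite leq_max hN' ?orbT.
have S_le d : `|\sum_(0 <= n < N | mdegree (s n) == d) a n| <= G / 2 ^+ d.
  apply: le_trans (degree_pow_le d G0); have [N' [NN' hN']] := finite d.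
  apply: (degree_partial_sum_le s_compat NN' lenm) => t t1.
  by rewrite -(homogeneous_part_multiplier f t x hN') P_le.
have S_close d : (d < D)%N ->
    `|homogeneous_part f d y - \sum_(0 <= n < N | mdegree (s n) == d) a n| <= eta / 2 ^+ d.
  move=> dD; apply: le_trans (degree_pow_le d (ltW eta0)); have [N' [NN' hN']] := finite d.
  have hN n : (mlen (s n) <= M)%N -> mdegree (s n) = d -> (n < N)%N.
    by move=> nM nd; rewrite (leq_trans (hN0 n nM _))// nd.
  have hN'M n : (mlen (s n) <= M)%N -> mdegree (s n) = d -> (n < N')%N.
    by move=> nM nd; rewrite (leq_trans (hN n nM nd)).
  pose c n := if (mlen (s n) <= M)%N then 0 else a n.
  have -> : homogeneous_part f d y - \sum_(0 <= n < N | mdegree (s n) == d) a n =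
      - \sum_(0 <= n < N | mdegree (s n) == d) c n.
    rewrite (homogeneous_part_multiplier f (fun=> 1) x hN).
    rewrite [X in _ - X](bigID (fun n => (mlen (s n) <= M)%N)) /= opprD addrA.
    rewrite (eq_big (fun n => (mdegree (s n) == d) && (mlen (s n) <= M)%N) a); last 2 first.
    - by move=> n; rewrite andbC.
    - by move=> n _; rewrite [X in _ * X]big1 ?mulr1// => i _; rewrite expr1n.
    rewrite subrr add0r; congr (- _).
    rewrite [RHS](bigID (fun n => (mlen (s n) <= M)%N)) /= [X in _ = X + _]big1 ?add0r.
      by apply: eq_bigr => n /andP[_ /negPf nM]; rewrite /c nM.
    by move=> n /andP[_ nM]; rewrite /c nM.
  rewrite normrN; apply: (degree_partial_sum_le s_compat NN' lenm) => t t1.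
  have := P_close d m x t Ax t1 Mm.
  rewrite (homogeneous_part_multiplier f t x hN') (homogeneous_part_multiplier f t x hN'M).
  congr (`|_| <= _).
  rewrite (bigID (fun n => (mlen (s n) <= M)%N)) [RHS](bigID (fun n => (mlen (s n) <= M)%N)) /=.
  rewrite [X in _ = X + _]big1 ?add0r; last first.
    by move=> n /andP[_ nM]; rewrite /c nM mul0r.
  rewrite (eq_bigl (fun n => (mlen (s n) <= M)%N && (mdegree (s n) == d))); last first.
    by move=> n; case: (leqP (mlen (s n)) M) => [nM|_]; rewrite ?andbF// andbT (leq_trans nM).
  rewrite (eq_bigr (fun n => a n * \prod_(i < m) t i ^+ s n i)) => [|n _]; last by [].
  rewrite [X in _ - X](eq_bigr (fun n => a n * \prod_(i < m) t i ^+ s n i)); last first.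
    move=> n /andP[nM _]; congr (_ * _).
    rewrite -!(big_mkord xpredT (fun i => t i ^+ s n i)).
    rewrite [RHS](big_cat_nat (n := M))//= [X in _ = _ * X](_ : _ = 1) ?mulr1//.
    rewrite big_nat big1// => i /andP[Mi _].
    by rewrite mlen_eq0 ?expr0// (leq_trans nM).
  rewrite addrAC subrr add0r; apply: eq_bigr => n /andP[_ /negPf nM].
  by rewrite /c nM.
have y_sum : `|f y - \sum_(d < D) homogeneous_part f d y| <= 2 * G / 2 ^+ D.
  apply: (homogeneous_part_sum archK ballK); first exact: entire_line_entire.
    exact: entire_polydisc_bounded.
  by move=> u u1; rewrite scaleE; apply: hG => //; exact: scale.
rewrite -/(a _) (partial_sum_degrees a degD') (big_cat_nat (n := D))//=.
rewrite (_ : f x - _ = (f x - f y) + (f y - \sum_(d < D) homogeneous_part f d y)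
   + \sum_(0 <= d < D) (homogeneous_part f d y - \sum_(0 <= n < N | mdegree (s n) == d) a n)
   - \sum_(D <= d < D') \sum_(0 <= n < N | mdegree (s n) == d) a n); last first.
  by rewrite sumrB !big_mkord; ring.
have tail : `|\sum_(D <= d < D') \sum_(0 <= n < N | mdegree (s n) == d) a n| <= 2 * G / 2 ^+ D.
  rewrite (le_trans (ler_norm_sum _ _ _))// (@le_trans _ _ (\sum_(D <= d < D') G * 2 ^- d))//.
    by apply: ler_sum.
  by rewrite -mulr_sumr [2 * G]mulrC -mulrA ler_wpM2l// sum_geometric_tail.
have middle : `|\sum_(0 <= d < D) (homogeneous_part f d y - \sum_(0 <= n < N | mdegree (s n) == d) a n)| <= 2 * eta.
  rewrite (le_trans (ler_norm_sum _ _ _))// (@le_trans _ _ (\sum_(0 <= d < D) eta * 2 ^- d))//.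
    by rewrite big_nat [leRHS]big_nat; apply: ler_sum => d /andP[_ dD]; exact: S_close.
  by rewrite -mulr_sumr mulrC ler_pM2r// (le_trans (sum_geometric_tail _ _ _))// expr0 divr1.
rewrite (le_trans (ler_normB _ _))// (le_trans (lerD (ler_normD _ _) (lexx _)))//.
rewrite (le_trans (lerD (lerD (ler_normD _ _) (lexx _)) (lexx _)))//.
apply: le_trans (lerD (lerD (lerD (f_close x Ax) y_sum) middle) tail) _.
rewrite (_ : _ + _ = 3 * eta + 8 * G / 2 ^+ D / 2); last by field; rewrite expf_neq0 ?pnatr_eq0.
rewrite (@le_trans _ _ (3 * eta + eps / 2))//; first by rewrite lerD2l ler_pM2r ?invr_gt0//; exact: ltW hD.
rewrite -subr_ge0 (_ : _ - _ = eta) ?(ltW eta0)//.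
by rewrite /eta; field.
Qed.

End monomial_expansion.

(** * The monomials form a Schauder basis *)

Section monomial_basis.
Context {K : numClosedFieldType} {X : completeNormedModType K} (e : nat -> X).
Context (archK : archimedean_field K) (ballK : compact_balls K).
Context (e_basis : schauder_basis e) (e_unc : unconditional e).
Context (s : nat -> multiindex) (s_compat : compatible_ordering s).

Let monomials n : entire_space X := monomial e_basis (s n).

Lemma coef_combination m (z : nat -> K) i : (forall j, (m <= j)%N -> z j = 0) ->
  coef e i (combination e m z) = z i.
Proof.
move=> z0; have zE : expansion e z (combination e m z).
  apply/cvgrPdist_lt => eps e0; exists m => // n /= mn.
  by rewrite /series /= big_mkord -/(combination e n z) (combination_widen e mn z0) subrr normr0.
by have := coef_unique e_basis zE => /(congr1 (@^~ i)).
Qed.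

Lemma entire_seriesE (a : nat -> K) n (x : X) :
  series (fun k => a k *: monomials k) n x =
  \sum_(0 <= k < n) a k * monomial_fun e (s k) x.
Proof.
rewrite /series /=; elim: n => [|n ih]; first by rewrite !big_geq.
by rewrite !big_nat_recr//= -ih.
Qed.

Lemma entire_cvgP (u : nat -> entire_space X) (f : entire_space X) :
  u @ \oo --> f <-> forall (A : set X) (r : K), compact A -> 0 < r ->
    exists N, forall n, (N <= n)%N -> forall y, A y -> `|f y - u n y| < r.
Proof.
split=> [uf A r cA r0|h U /nbhs_entireP[A [r [cA r0 AU]]]].
  have fU : nbhs f [set g : entire_space X | forall y, A y -> `|f y - g y| < r].
    by apply/nbhs_entireP; exists A, r; split.
  by have [N _ hN] := uf _ fU; exists N => n /hN.
have [N hN] := h A r cA r0; exists N => // n /hN; exact: AU.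
Qed.

Lemma monomial_expansion (f : entire_space X) :
  expansion monomials (fun n => coefficient e f (s n)) f.
Proof.
apply/entire_cvgP => A r cA r0; have r20 : 0 < r / 2 by rewrite divr_gt0.
have [N hN] := monomial_expansion_uniform archK ballK e_basis e_unc s_compat f cA r20.
exists N => n Nn y Ay; rewrite entire_seriesE (le_lt_trans (hN n Nn y Ay))//.
by rewrite ltr_pdivrMr// ltr_pMr// ltr1n.
Qed.

(** The coefficient functional is continuous and is exact on partial sums, whose
    coefficients it eventually reads off. *)
Lemma monomial_expansion_unique (f : entire_space X) (a : nat -> K) n :
  expansion monomials a f ->
  a n = coefficient e f (s n).
Proof.
move=> /entire_cvgP fa; apply/eqP; rewrite eq_sym -subr_eq0 -normr_le0; apply: ler_eps;
  rewrite ?normr_real ?real0// => eps e0; rewrite add0r.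
pose be := s n; pose m := mlen be.
have [N0 hN0] := fa _ eps (@polydisc_compact K X ballK e m 1) e0.
pose N := maxn N0 n.+1.
pose M := maxn m (\max_(k < N) mlen (s k)).
have lenM k : (k < N)%N -> (mlen (s k) <= M)%N.
  by move=> kN; rewrite leq_max; apply/orP; right; exact: (leq_bigmax (Ordinal kN)).
have mM : (m <= M)%N by rewrite leq_maxl.
pose Q : seq (K * (nat -> nat)) := [seq (a k, s k : nat -> nat) | k <- index_iota 0 N].
have := @coefficient_dist K X ballK e f be M Q eps (@entire_polydisc_bounded K X archK ballK f) mM.
rewrite (_ : \sum_(q <- Q) _ = a n).
  apply=> z zt; have [z0 z1] := zt.
  have combE : combination e M z = combination e m z by exact: combination_widen.
  have := hN0 N (leq_maxl _ _) (combination e m z).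
  rewrite entire_seriesE combE => h.
  rewrite (_ : polynomial M Q z = \sum_(0 <= k < N) a k * monomial_fun e (s k) (combination e m z)).
    by apply/ltW/h; exists z => // i; exact: in_torus_le zt.
  rewrite /polynomial big_map big_nat [RHS]big_nat; apply: eq_bigr => k /andP[_ kN] /=.
  rewrite (monomial_funE e _ (lenM k kN)); congr (_ * _); apply: eq_bigr => i _.
  by rewrite coef_combination.
rewrite big_map (bigD1_seq n) ?iota_uniq//=; last first.
  by rewrite mem_index_iota /=; exact: leq_maxr.
rewrite [X in a n * X]big1 ?mulr1; last by move=> i _; rewrite eqxx.
rewrite big_seq_cond big1 ?addr0// => k /andP[kN kn]; rewrite mem_index_iota /= in kN.
have [i /negPf ni] : exists i : 'I_M, s k i != be i.
  apply: contrapT => h; move/eqP: kn; apply; apply: (compatible_inj s_compat).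
  apply: (multiindex_eq (lenM k kN) mM) => i iM; apply: contrapT => /eqP ki.
  by apply: h; exists (Ordinal iM).
by rewrite (bigD1 i)//= ni mul0r mulr0.
Qed.

Theorem monomial_schauder_basis : schauder_basis monomials.
Proof.
have uniq_exp (f : entire_space X) : exists! a, expansion monomials a f.
  exists (fun n => coefficient e f (s n)); split; first exact: monomial_expansion.
  by move=> a fa; apply/funext => n; rewrite (monomial_expansion_unique n fa).
split=> // n f; have coefE (g : entire_space X) :
    coef monomials n g = coefficient e g (s n).
  have h := @xgetPex _ (fun=> 0) [set a | expansion monomials a g]
     (ex_intro _ (fun n => coefficient e g (s n)) (@monomial_expansion g)).
  exact: (monomial_expansion_unique n h).
apply: (proj2 (@cvgrPdist_le K K^o _ (nbhs f) (nbhs_filter f) _ _)) => eps e0.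
pose m := mlen (s n).
have fU : nbhs f [set g : entire_space X | forall y, polydisc e m 1 y -> `|f y - g y| < eps].
  apply/nbhs_entireP; exists (polydisc e m 1), eps.
  by split => //; exact: (@polydisc_compact K X ballK e m 1).
refine (@filterS _ (nbhs f) (nbhs_filter f) _ _ _ fU) => g /= fg.
rewrite !coefE; apply: (coefficient_sub ballK).
- exact: entire_polydisc_bounded.
- exact: entire_polydisc_bounded.
- by move=> z zt; apply/ltW/fg; exists z => // i; exact: in_torus_le zt.
Qed.

End monomial_basis.

Theorem corollary5p3 (R : realType) (X : completeNormedModType R[i])
    (e : nat -> X) (e_basis : schauder_basis e) (e_unc : unconditional e)
    (s : nat -> multiindex) (s_compat : compatible_ordering s) :
  schauder_basis (fun n => monomial e_basis (s n) : entire_space X).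
Proof.
exact: (@monomial_schauder_basis R[i] X e (@complex_archimedean R) (@complex_ball_compact R)).
Qed.
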